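(* Let $\mathcal{T}$ be a (possibly infinite) stopping time with respect to the natural filtration $\{\mathcal{F}_t\}$ of a $K$-armed stochastic multi-armed bandit (MAB) experiment. Fix $k \in [K]$ and suppose $N_k(\mathcal{T}) \geq 1$. Let $C \in \mathcal{F}_{\mathcal{T}}$ be any event with $\mathbb{P}(C) > 0$. (i) Assume that, for each $i \in \mathbb{N}$, the function $\mathcal{D}^*_\infty \mapsto \mathbb{1}(C)/N_k(\mathcal{T})$ is a decreasing function of $X_{i,k}^*$ while keeping all other entries in $\mathcal{D}^*_\infty$ fixed. Then $$\inf_{y \in \mathbb{R}}\left(\mathbb{E}\left[\hat{F}_{k,\mathcal{T}}(y) \mid C\right] - F_k(y)\right) \geq 0,$$ or, equivalently, for any non-decreasing function $f:\mathbb{R}\to\mathbb{R}$ with $\mathbb{E}\left[\hat{E}_{k,\mathcal{T}}|f| \mid C\right] < \infty$ and $E_k|f| < \infty$, $$\mathbb{E}\left[\hat{E}_{k,\mathcal{T}} f \mid C\right] \leq E_k f.$$ (ii) Similarly, if, for each $i \in \mathbb{N}$, the function $\mathcal{D}^*_\infty \mapsto \mathbb{1}(C)/N_k(\mathcal{T})$ is an increasing function of $X_{i,k}^*$ while keeping all other entries in $\mathcal{D}^*_\infty$ fixed, then $$\sup_{y \in \mathbb{R}}\left(\mathbb{E}\left[\hat{F}_{k,\mathcal{T}}(y) \mid C\right] - F_k(y)\right) \leq 0,$$ or, equivalently, $$\mathbb{E}\left[\hat{E}_{k,\mathcal{T}} f \mid C\right] \geq E_k f$$ for any non-decreasing function $f:\mathbb{R}\to\mathbb{R}$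 with $\mathbb{E}\left[\hat{E}_{k,\mathcal{T}}|f| \mid C\right] < \infty$ and $E_k|f| < \infty$.
   Context: Notation: $[K]=\{1,\dots,K\}$. $P_1,\dots,P_K$ are probability distributions on $\mathbb{R}$ (the arms) with finite means $\mu_k = \int x\,\mathrm{d}P_k(x)$. Inequalities and equalities between random variables are understood almost surely. ''Increasing'' and ''decreasing'' are meant in the weak sense. Tabular model of a MAB experiment. $X^*_\infty = \{X_{i,k}^*\}_{i\in\mathbb{N},k\in[K]}$ is a table of independent random variables with $X_{i,k}^* \sim P_k$. $\{W_t\}_{t\ge 0}$ is a sequence of random variables, independent of $X^*_\infty$, representing all external randomness. Let $\mathcal{D}^*_\infty = X^*_\infty \cup \{W_t\}_{t=0}^\infty$. At each time $t\geq 1$, an arm $A_t\in[K]$ is selected as a (measurable) function of the data $\mathcal{D}_{t-1}$ observed so far, where $\mathcal{D}_t$ consists of $W_0$ and $(A_s,Y_s,W_s)$ for $1\le s\le t$. With $N_k(t) = \sum_{s=1}^t \mathbb{1}(A_s=k)$, the reward observed at time $t$ is $Y_t = X^*_{i,k}$ when $A_t=k$ and $N_k(t)=i$. The natural filtration is $\mathcal{F}_t=\sigma(\mathcal{D}_t)$, so $A_t$ is $\mathcal{F}_{t-1}$-measurable and $Y_t$ is $\mathcal{F}_t$-measurable. Every quantity of the experiment (e.g. $A_t$, $N_k(t)$, $\mathcal{T}$, $\mathbb{1}(C)$) is a deterministic function of $\mathcal{D}^*_\infty$. A function of $\mathcal{D}^*_\infty$ is increasing (decreasing) in $X_{i,k}^*$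 with all other entries fixed if it is so as a function of the single real entry $X_{i,k}^*$ for every fixed value of the remaining entries. For a stopping time $\mathcal{T}$, $N_k(\mathcal{T}) = \lim_{t\to\infty} N_k(\mathcal{T}\wedge t) \in \mathbb{N}\cup\{\infty\}$, with the convention $1/\infty=0$. $F_k(y)=P_k((-\infty,y])$ is the CDF of arm $k$, and for $f$ integrable with respect to $P_k$, $E_k f = \int f\,\mathrm{d}P_k$. The empirical CDF and empirical expectation of arm $k$ at time $t$ (when $N_k(t)\ge 1$) are $$\hat{F}_{k,t}(y) = \frac{1}{N_k(t)}\sum_{s=1}^t \mathbb{1}(A_s=k,\,Y_s\le y),\qquad \hat{E}_{k,t}f = \frac{1}{N_k(t)}\sum_{s=1}^t f(Y_s)\,\mathbb{1}(A_s=k),$$ and at a stopping time $\hat{F}_{k,\mathcal{T}}(y) = \lim_{t\to\infty}\hat{F}_{k,\mathcal{T}\wedge t}(y)$ and $\hat{E}_{k,\mathcal{T}}f=\lim_{t\to\infty}\hat{E}_{k,\mathcal{T}\wedge t}f$. (On $\{N_k(\mathcal{T})=\infty\}$ these limits equal $F_k(y)$ and $E_kf$ almost surely.) *)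

(* Defs.v *)
From HB Require Import structures.
From mathcomp Require Import all_boot all_order all_algebra.
From mathcomp Require Import all_classical all_reals all_analysis.

Set Implicit Arguments.
Unset Strict Implicit.
Unset Printing Implicit Defensive.

Import Order.TTheory GRing.Theory Num.Theory.
Import numFieldNormedType.Exports.

Local Open Scope classical_set_scope.
Local Open Scope ring_scope.

Section independence.
Context {d} {T : measurableType d} {R : realType} (P : probability T R).

Definition mutually_independent {I : eqType} {d'} {T' : measurableType d'}
    (X : I -> T -> T') : Prop :=
  forall (s : seq I) (B : I -> set T'), uniq s ->
    (forall i, measurable (B i)) ->
    P (\bigcap_(i in [set` s]) (X i @^-1` B i)) =
    (\big[*%E/1]_(i <- s) P (X i @^-1` B i))%E.

Definition independent_systems (F G : set (set T)) : Prop :=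
  forall A B, F A -> G B -> P (A `&` B) = (P A * P B)%E.

(* [E[Z | C]] for an event [C] of positive probability *)
Definition cond_expectation (C : set T) (Z : T -> R) : \bar R :=
  ((\int[P]_(w in C) (Z w)%:E) / P C)%E.

End independence.

Definition sigma_family {T I : Type} {d'} {T' : measurableType d'}
    (X : I -> T -> T') : set (set T) :=
  <<s \bigcup_i preimage_set_system setT (X i) measurable >>.

(* A point of [data_star K R TW] is a value of [D*_oo]: [x.1 i a] is the entry
   of the table read at the [(i+1)]-st pull of arm [a] (rows are numbered from
   0), and [x.2 t] is the value of [W_t]. *)
Definition data_star (K : nat) (R TW : Type) : Type :=
  ((nat -> 'I_K -> R) * (nat -> TW))%type.

(* Values of [D_t]: [W_0] and the triples [(A_s, Y_s, W_s)], [1 <= s <= t], in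
   chronological order. Arms are recorded by their number in [nat], which
   carries the discrete sigma-algebra. *)
Notation hist R TW t := (TW * t.-tuple (nat * R * TW))%type.

Section experiment.
Context {R : realType} {dW : measure_display} {TW : measurableType dW}.
Context {K : nat}.
Implicit Types (x : data_star K R TW) (a k : 'I_K) (t : nat).

Definition sigma_star : set (set (data_star K R TW)) :=
  <<s sigma_family (fun (ia : nat * 'I_K) (x : data_star K R TW) =>
                      x.1 ia.1 ia.2)
      `|` sigma_family (fun t (x : data_star K R TW) => x.2 t) >>.

Definition set_entry (i : nat) (k : 'I_K) (z : R) (x : data_star K R TW)
    : data_star K R TW :=
  (fun j b => if (j == i) && (b == k) then z else x.1 j b, x.2).

Definition increasing_in_entry (i : nat) (k : 'I_K)
    (g : data_star K R TW -> \bar R) : Prop :=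
  forall (x : data_star K R TW) (z1 z2 : R), z1 <= z2 ->
    (g (set_entry i k z1 x) <= g (set_entry i k z2 x))%E.

Definition decreasing_in_entry (i : nat) (k : 'I_K)
    (g : data_star K R TW -> \bar R) : Prop :=
  forall (x : data_star K R TW) (z1 z2 : R), z1 <= z2 ->
    (g (set_entry i k z2 x) <= g (set_entry i k z1 x))%E.

Definition pulls_in {t} (a : 'I_K) (h : hist R TW t) : nat :=
  count (fun o => o.1.1 == a :> nat) h.2.

(* [policy t] selects the arm [A_(t+1)] from [D_t]. *)
Variable policy : forall t, hist R TW t -> 'I_K.

Definition measurable_policy : Prop :=
  forall t a, measurable (@policy t @^-1` [set a]).

(* [D_t] as a function of [D*_oo]. In the step to time [t+1] the arm [a] has
   been pulled [N_a(t) = N_a(t+1) - 1] times before, so that the reward is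
   entry number [N_a(t)] of column [a], counting from 0. *)
Fixpoint history (x : data_star K R TW) (t : nat) : hist R TW t :=
  match t with
  | 0 => (x.2 0, [tuple])
  | t'.+1 =>
      let h := history x t' in
      let a := policy h in
      (h.1, rcons_tuple h.2 (a : nat, x.1 (pulls_in a h) a, x.2 t'.+1))
  end.

Definition natural_filtration (t : nat) : set (set (data_star K R TW)) :=
  preimage_set_system setT (fun x => history x t) measurable.

(* Extended times are of type [option nat], with [None] for infinity. *)
Definition time_le (T : data_star K R TW -> option nat) (t : nat)
    : set (data_star K R TW) :=
  [set x | if T x is Some n then (n <= t)%N else false].

Definition time_min (T : option nat) (t : nat) : nat :=
  if T is Some n then minn n t else t.

Definition stopping_time (T : data_star K R TW -> option nat) : Prop :=
  forall t, natural_filtration t (time_le T t).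

Definition stopped_sigma_algebra (T : data_star K R TW -> option nat)
    : set (set (data_star K R TW)) :=
  [set C | sigma_star C /\
           forall t, natural_filtration t (C `&` time_le T t)].

Definition pulls (k : 'I_K) (t : nat) (x : data_star K R TW) : nat :=
  pulls_in k (history x t).

Definition emp_cdf (k : 'I_K) (y : R) (t : nat) (x : data_star K R TW) : R :=
  (pulls k t x)%:R^-1 *
  (count (fun o => (o.1.1 == k :> nat) && (o.1.2 <= y)) (history x t).2)%:R.

Definition emp_mean (k : 'I_K) (f : R -> R) (t : nat) (x : data_star K R TW)
    : R :=
  (pulls k t x)%:R^-1 *
  \sum_(o <- (history x t).2 | o.1.1 == k :> nat) f o.1.2.

Variable T : data_star K R TW -> option nat.

(* The limit is taken in [\bar R], where it always exists. *)
Definition stopped_pulls (k : 'I_K) (x : data_star K R TW) : \bar R :=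
  limn (fun t => (pulls k (time_min (T x) t) x)%:R%:E).

Definition stopped_emp_cdf (k : 'I_K) (y : R) (x : data_star K R TW) : R :=
  limn (fun t => emp_cdf k y (time_min (T x) t) x).

Definition stopped_emp_mean (k : 'I_K) (f : R -> R) (x : data_star K R TW)
    : R :=
  limn (fun t => emp_mean k f (time_min (T x) t) x).

(* [1(C) / N_k(T)]; the inverse of [\bar R] sends [+oo] to [0] and [0] to [+oo]. *)
Definition weight (C : set (data_star K R TW)) (k : 'I_K)
    (x : data_star K R TW) : \bar R :=
  ((\1_C x)%:E / stopped_pulls k x)%E.

End experiment.

(* [X] and [W] are the reward table and the external randomness, with rows of
   [X] numbered from 0. *)
Definition tabular_model {d} {Omega : measurableType d} {R : realType}
    (P : probability Omega R) {dW} {TW : measurableType dW} {K : nat}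
    (Pk : 'I_K -> probability R R)
    (X : nat -> 'I_K -> {RV P >-> R}) (W : nat -> {RV P >-> TW}) : Prop :=
  [/\ (forall i k (B : set R), measurable B ->
         distribution P (X i k) B = Pk k B),
      mutually_independent P
        (fun (ik : nat * 'I_K) (w : Omega) => X ik.1 ik.2 w)
    & independent_systems P
        (sigma_family (fun (ik : nat * 'I_K) (w : Omega) => X ik.1 ik.2 w))
        (sigma_family (fun t (w : Omega) => W t w)) ].

Definition realized_data {d} {Omega : measurableType d} {R : realType}
    {P : probability Omega R} {dW} {TW : measurableType dW} {K : nat}
    (X : nat -> 'I_K -> {RV P >-> R}) (W : nat -> {RV P >-> TW})
    (w : Omega) : data_star K R TW :=
  (fun i k => X i k w, fun t => W t w).

(* Main.v *)
(* Write [N] for [N_k(T)], possibly infinite. On [N < oo] the empirical mean of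
   [u] times [1(C)] is the sum over [i] of [u(X_i) g_i], where
   [g_i = 1(C) 1(i is read) / N]. Whether entry [i] is read before stopping does
   not depend on its value, so [g_i] is monotone in [X_i] as soon as [1(C) / N]
   is. Resampling [X_i] with all other entries fixed, Chebyshev's integral
   inequality compares [E(u(X_i) g_i)] with [E_k u * E g_i] for monotone [u >= 0];
   since the [g_i] sum to [1(C) 1(N < oo)], this settles the event [N < oo].

   On [N = oo] the empirical mean tends to [E_k u] by the strong law of large
   numbers. It is derived from Garsia's maximal inequality: if [E_k v < 0], the
   event [E] where the partial sums of [v(X_i)] are unbounded above is invariant
   under the shift of the column, hence independent of its first entry, and the
   inequality reads [0 <= E(v(X_0) 1(E)) = E_k v * P(E)], so that [P(E) = 0]. *)

Require Import Defs.
From HB Require Import structures.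
From mathcomp Require Import all_boot all_order all_algebra.
From mathcomp Require Import all_classical all_reals all_analysis.
From mathcomp Require Import measurable_realfun ring lra.

Set Implicit Arguments.
Unset Strict Implicit.
Unset Printing Implicit Defensive.

Import Order.TTheory GRing.Theory Num.Theory.
Import numFieldNormedType.Exports.

Local Open Scope classical_set_scope.
Local Open Scope ring_scope.

(** * A maximal ergodic inequality *)

(** [Omega] carries no map that redraws or shifts entries, so the argument is moved to the law of
    the data on the space of its values. There, overwriting an entry by a fresh draw and dropping
    the head of a column are measurable maps that preserve the law, which is checked on cylinders.
    Stopping is treated pointwise: an event of the natural filtration is a preimage under the
    history map, so it cannot separate two tables with the same history. The expectations of the g_i
    are never computed. The decomposition of the stopped mean, taken once more at u = 1, expresses
    the mass of C through the same g_i; the contributions of N = oo then agree on both sides, and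
    the comparison is made term by term in i. The condition u >= 0 comes from exchanging the series
    with the integral. A monotone f is therefore split into its positive and negative parts, one
    moving with f and the other against it, and the finiteness assumptions on |f| allow the two
    comparisons to be subtracted. *)

Section garsia.
Context {d : measure_display} {S : measurableType d} {R : realType}.
Variables (mu : probability S R) (theta : S -> S) (g : S -> R).
Hypothesis theta_meas : measurable_fun setT theta.
Hypothesis theta_pres : forall A, measurable A -> mu (theta @^-1` A) = mu A.
Hypothesis g_int : mu.-integrable setT (EFin \o g).

(** This is the maximum of the partial sums S_0 = 0, S_1, ..., S_n along the orbit. Peeling off the
    first step gives directly the recursion that Garsia's argument uses. *)
Fixpoint birkhoff_max (n : nat) (x : S) : R :=
  if n is n'.+1 then Num.max 0 (g x + birkhoff_max n' (theta x)) else 0.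

Fixpoint birkhoff_sum (n : nat) (x : S) : R :=
  if n is n'.+1 then g x + birkhoff_sum n' (theta x) else 0.

Definition birkhoff_unbounded : set S :=
  [set x | forall m : nat, exists n, m%:R < birkhoff_sum n x].

Let g_meas : measurable_fun setT g.
Proof. by apply/measurable_EFinP; exact: (measurable_int mu). Qed.

Let bsum_meas n : measurable_fun setT (birkhoff_sum n).
Proof.
elim: n => [|n IH] /=; first exact: measurable_cst.
by apply: measurable_funD => //; exact: measurableT_comp.
Qed.

Let bmax_meas n : measurable_fun setT (birkhoff_max n).
Proof.
elim: n => [|n IH] /=; first exact: measurable_cst.
apply: measurable_maxr; first exact: measurable_cst.
by apply: measurable_funD => //; exact: measurableT_comp.
Qed.

Let bmax_ge0 n x : 0 <= birkhoff_max n x.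
Proof. by case: n => [|n] //=; rewrite le_max lexx. Qed.

Let bmax_ndS n x : birkhoff_max n x <= birkhoff_max n.+1 x.
Proof.
elim: n x => [|n IH] x; first exact: bmax_ge0.
by rewrite /= ge_max le_max lexx /= le_max lerD2l IH orbT.
Qed.

Let bsum_le_bmax n x : birkhoff_sum n x <= birkhoff_max n x.
Proof.
by elim: n x => [|n IH] x //=; rewrite le_max lerD2l IH orbT.
Qed.

Lemma integral_measure_preserving (f : S -> \bar R) :
  measurable_fun setT f -> (forall x, (0 <= f x)%E) ->
  (\int[mu]_x f (theta x) = \int[mu]_x f x)%E.
Proof.
move=> mf f0.
rewrite -[LHS](ge0_integral_pushforward theta_meas mu measurableT mf) //.
apply: eq_measure_integral => A mA _.
exact: theta_pres.
Qed.

Lemma integrable_measure_preserving (f : S -> \bar R) :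
  mu.-integrable setT f -> mu.-integrable setT (f \o theta).
Proof.
move=> /integrableP[mf f_fin]; apply/integrableP; split.
  exact: measurableT_comp.
rewrite (integral_measure_preserving (f := fun x => `|f x|%E)) //.
exact: measurableT_comp.
Qed.

Let bmax_int n : mu.-integrable setT (EFin \o birkhoff_max n).
Proof.
elim: n => [|n IH].
  rewrite (_ : _ \o _ = cst 0%E); first exact: integrable0.
  by apply/funext => x.
have I1 := integrable_measure_preserving IH.
apply: (@le_integrable _ _ _ _ _ _ _
  (fun x => `|(g x)%:E| + (birkhoff_max n (theta x))%:E)%E) => //.
- exact/measurable_EFinP.
- move=> x _ /=; rewrite lee_fin ger0_norm ?le_max ?lexx //.
  rewrite ger0_norm; last by rewrite addr_ge0.
  by rewrite ge_max addr_ge0 //= lerD2r ler_norm.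
- by apply: integrableD => //; exact: integrable_abse.
Qed.

Lemma birkhoff_unbounded_meas : measurable birkhoff_unbounded.
Proof.
rewrite (_ : birkhoff_unbounded =
  \bigcap_m \bigcup_n (birkhoff_sum n @^-1` `]m%:R, +oo[%classic)).
  apply: bigcapT_measurable => m; apply: bigcupT_measurable => n.
  by rewrite -[X in measurable X]setTI; exact: bsum_meas.
apply/seteqP; split => x /=.
  by move=> h m _; have [n] := h m; exists n => //=; rewrite in_itv /= andbT.
by move=> h m; have [n _ /=] := h m I; rewrite in_itv /= andbT; exists n.
Qed.

(** The sums started at x and at [theta x] differ by the fixed number [g x], which is absorbed by
    raising the threshold by a natural number above its absolute value. *)
Lemma birkhoff_unbounded_inv : theta @^-1` birkhoff_unbounded = birkhoff_unbounded.
Proof.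
apply/seteqP; split => x /= h m.
  have [n hn] := h (m + (Num.truncn `|g x|).+1)%N.
  exists n.+1 => /=; move: hn; rewrite natrD.
  have := truncnS_gt `|g x|; have := ler_norm (- g x); rewrite normrN.
  set a := (_.+1%:R); lra.
have [[|n] hn] := h (m + (Num.truncn `|g x|).+1)%N.
  (* The empty sum 0 exceeds no natural threshold, so the witness is a successor. *)
  by move: hn => /=; rewrite ltNge ler0n.
exists n; move: hn => /=; rewrite natrD.
have := truncnS_gt `|g x|; have := ler_norm (g x).
set a := (_.+1%:R); lra.
Qed.

Let E := birkhoff_unbounded.

(* Garsia's argument: [M_(n+1) - M_(n+1) o theta <= g * 1(M_(n+1) > 0)] for
   [M_n = birkhoff_max n], restricted to the invariant event [E]. *)
Lemma birkhoff_unbounded_integral_ge0 : (0 <= \int[mu]_(x in E) (g x)%:E)%E.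
Proof.
have mE : measurable E := birkhoff_unbounded_meas.
pose D n := E `&` [set x | 0 < birkhoff_max n x].
have mD n : measurable (D n).
  apply: measurableI => //.
  rewrite (_ : [set _ | _] = birkhoff_max n @^-1` `]0, +oo[%classic).
    by rewrite -[X in measurable X]setTI; exact: bmax_meas.
  by apply/seteqP; split => x /=; rewrite in_itv /= andbT.
(* In M_(n+1) = g + M_n o theta, the last term is enlarged to M_(n+1) o theta: both sides then
   integrate the same function on the invariant event [E], and these two integrals cancel. *)
have step n : (0 <= \int[mu]_x (g x * \1_(D n.+1) x)%:E)%E.
  have H x : (\1_E x * birkhoff_max n.+1 x)
      <= g x * \1_(D n.+1) x + \1_E (theta x) * birkhoff_max n.+1 (theta x).
    rewrite (_ : \1_E (theta x) = \1_E x); last first.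
      have Ex : E (theta x) = E x := congr1 (fun A => A x) birkhoff_unbounded_inv.
      have Em : (theta x \in E) = (x \in E) by apply/idP/idP; rewrite !inE Ex.
      by rewrite !indicE Em.
    rewrite /D indicI /= !indicE.
        have [xE|xE] := boolP (x \in E); last by rewrite !mul0r mulr0 addr0.
    rewrite !mul1r.
    have [p|p] := boolP (x \in [set x | 0 < birkhoff_max n.+1 x]).
      rewrite mulr1; move: p; rewrite inE /= lt_max ltxx /= => p.
      rewrite max_r ?(ltW p) // lerD2l; exact: bmax_ndS.
    rewrite mulr0 add0r; apply: (@le_trans _ _ 0); last exact: (bmax_ge0 n.+1 (theta x)).
    by rewrite leNgt; apply: contra p; rewrite inE.
  have I1 : mu.-integrable setT (fun x => (g x * \1_(D n.+1) x)%:E).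
    under eq_fun do rewrite EFinM.
    apply: (@le_integrable _ _ _ _ _ _ _ (EFin \o g)) => //.
      by apply: emeasurable_funM; apply/measurable_EFinP => //; exact: measurable_indic.
    move=> x _; rewrite /= lee_fin normrM indicE.
    by case: (_ \in _); rewrite ?normr1 ?normr0 ?mulr1 ?mulr0.
  have mf : measurable_fun setT (fun x => (\1_E x * birkhoff_max n.+1 x)%:E).
    by apply/measurable_EFinP; apply: measurable_funM => //; exact: measurable_indic.
  have f0 x : (0 <= (\1_E x * birkhoff_max n.+1 x)%:E)%E.
    by rewrite lee_fin mulr_ge0.
  have I2 : mu.-integrable setT (fun x => (\1_E x * birkhoff_max n.+1 x)%:E).
    apply: (@le_integrable _ _ _ _ _ _ _ (EFin \o birkhoff_max n.+1)) => //.
    move=> x _; rewrite /= lee_fin normrM indicE.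
    by case: (_ \in _); rewrite ?normr1 ?normr0 ?mul1r ?mul0r.
  have I3 : mu.-integrable setT
      (fun x => (\1_E (theta x) * birkhoff_max n.+1 (theta x))%:E).
    exact: integrable_measure_preserving I2.
  have : (\int[mu]_x (\1_E x * birkhoff_max n.+1 x)%:E <=
     \int[mu]_x ((g x * \1_(D n.+1) x)%:E +
        (\1_E (theta x) * birkhoff_max n.+1 (theta x))%:E))%E.
    apply: le_integral => //; first exact: (integrableD measurableT I1 I3).
    by move=> x _; rewrite lee_fin.
  rewrite integralD // (integral_measure_preserving mf f0) -leeBlDr; last first.
    exact: integrable_fin_num.
  by rewrite subee //; exact: integrable_fin_num.
(* On [E] some partial sum is positive, so x lies in [D n] from some index on; |g| dominates. *)
have cvgg x : (g x * \1_(D n.+1) x)%:E @[n --> \oo] --> (g x * \1_E x)%:E.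
  apply: cvg_near_cst.
  have [xE|xE] := pselect (E x); last first.
    by near=> n; rewrite !indicE !memNset // => -[].
  have [n0 hn0] := xE 0%N; exists n0 => // n /= hn.
  rewrite !indicE !mem_set //; split => //=.
  apply: (@lt_le_trans _ _ (birkhoff_max n0 x)).
    exact: lt_le_trans hn0 (bsum_le_bmax _ _).
  have nd := @homo_leq _ (fun n => birkhoff_max n x) (fun a b => a <= b).
  apply: (nd _ _ _ n0 n.+1) => //; first by move=> y; exact: le_trans.
  exact: leqW.
have gfin x : setT x -> `|(g x)%:E|%E \is a fin_num by [].
have gD n x : (`|(g x * \1_(D n.+1) x)%:E| <= `|(g x)%:E|)%E.
  rewrite lee_fin normrM indicE.
  by case: (_ \in _); rewrite ?normr1 ?normr0 ?mulr1 ?mulr0.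
have := dominated_cvg measurableT
  (f_ := fun n x => (g x * \1_(D n.+1) x)%:E) (f := fun x => (g x * \1_E x)%:E)
  _ (fun x _ => cvgg x) gfin (integrable_abse g_int) (fun n x _ => gD n x).
have mgD n : measurable_fun setT (fun x => (g x * \1_(D n.+1) x)%:E).
  by apply/measurable_EFinP; apply: measurable_funM => //; exact: measurable_indic.
move=> /(_ mgD) cvgi.
rewrite integral_mkcond.
rewrite (_ : _ \_ E = fun x => (g x * \1_E x)%:E).
  rewrite -(cvg_lim _ cvgi) //; apply: lime_ge.
    by apply/cvg_ex; eexists; exact: cvgi.
  exact: nearW.
apply/funext => x; rewrite patchE indicE.
by case: (_ \in _); rewrite ?mulr1 ?mulr0.
Unshelve. all: by end_near. Qed.

(** The factorisation over invariant events takes the place of ergodicity. For the column of an arm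
    it follows from the independence of a single entry. *)
Lemma birkhoff_sum_bounded :
  (forall A, measurable A -> theta @^-1` A = A ->
     (\int[mu]_(x in A) (g x)%:E = (\int[mu]_x (g x)%:E) * mu A)%E) ->
  (\int[mu]_x (g x)%:E < 0)%E ->
  {ae mu, forall x, exists m : nat, forall n, birkhoff_sum n x <= m%:R}.
Proof.
move=> indep neg; exists birkhoff_unbounded; split.
- exact: birkhoff_unbounded_meas.
- have := birkhoff_unbounded_integral_ge0.
  rewrite indep; [|exact: birkhoff_unbounded_meas|exact: birkhoff_unbounded_inv].
  move=> h; apply/eqP; rewrite -measure_le0 leNgt; apply/negP => muE.
  by move: h; rewrite leNgt => /negP; apply; rewrite nmule_rlt0.
- move=> x /= h m; apply: contrapT => hn; apply: h; exists m => n.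
  by rewrite leNgt; apply/negP => hlt; apply: hn; exists n.
Qed.

End garsia.

(** * The law of the data *)

Section star_space.
Context {R : realType} {dW : measure_display} {TW : measurableType dW} {K : nat}.

(** [sigma_star] is only a set of sets; this alias of [data_star] makes it the measurable structure
    of the type, so that functions of the data apply to it directly. *)
Definition star : Type :=
  g_sigma_algebraType (@sigma_star R dW TW K).
HB.instance Definition _ := Measurable.on star.

(** The sequence of the W_t is kept as one block, because the model says nothing about its joint
    law. *)
Definition noise : Type :=
  g_sigma_algebraType (\bigcup_t preimage_set_system setT
    (fun v : nat -> TW => v t) measurable).
HB.instance Definition _ := Measurable.on noise.

Lemma star_measurableE : (@measurable _ star) = sigma_star.
Proof. by rewrite /measurable /= sigma_algebra_id //; exact: smallest_sigma_algebra. Qed.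

Lemma measurable_entry i (a : 'I_K) :
  measurable_fun setT (fun x : star => x.1 i a).
Proof.
move=> _ B mB; apply: sub_sigma_algebra; apply: sub_sigma_algebra; left.
by apply: sub_sigma_algebra; exists (i, a) => //; exists B.
Qed.

Definition star_noise (x : star) : noise := x.2.

Lemma measurable_star_noise : measurable_fun setT star_noise.
Proof.
apply: (@measurability _ _ _ noise _ _ (\bigcup_t preimage_set_system setT
    (fun v : nat -> TW => v t) measurable)) => // _ [_ [t _ [B mB <-]] <-].
apply: sub_sigma_algebra; apply: sub_sigma_algebra; right.
by apply: sub_sigma_algebra; exists t => //; exists B => //; rewrite !setTI.
Qed.

Lemma measurable_noise t : measurable_fun setT (fun x : star => x.2 t).
Proof.
move=> _ B mB; apply: sub_sigma_algebra; apply: sub_sigma_algebra; right.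
by apply: sub_sigma_algebra; exists t => //; exists B.
Qed.

Lemma measurable_preimage_g_sigma d (S : measurableType d) (U : pointedType)
    (G : set (set U)) (f : S -> U) :
  (forall A, G A -> measurable (f @^-1` A)) ->
  forall A, <<s G>> A -> measurable (f @^-1` A).
Proof.
move=> fG A GA.
have mf : measurable_fun setT (f : S -> g_sigma_algebraType G).
  apply: (@measurability _ _ _ (g_sigma_algebraType G) _ _ G) => // _ [B GB <-].
  by rewrite setTI; exact: fG.
by rewrite -[X in measurable X]setTI; exact: (mf measurableT).
Qed.

Lemma measurable_to_star d (S : measurableType d) (f : S -> star) :
  (forall i a, measurable_fun setT (fun s => (f s).1 i a)) ->
  (forall t, measurable_fun setT (fun s => (f s).2 t)) ->
  measurable_fun setT f.
Proof.
move=> fX fW _ A mA; rewrite setTI.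
apply: (measurable_preimage_g_sigma (G := sigma_star)) mA => {}A mA.
apply: measurable_preimage_g_sigma mA => {}A [mA|mA]; apply: measurable_preimage_g_sigma mA => {}A [].
- move=> [i a] _ [B mB <-]; rewrite setTI.
  by rewrite -[X in measurable X]setTI; exact: fX.
- move=> t _ [B mB <-]; rewrite setTI.
  by rewrite -[X in measurable X]setTI; exact: fW.
Qed.

Definition cylinder (B : nat -> 'I_K -> set R) (E : set noise) : set star :=
  [set x | forall i a, B i a (x.1 i a)] `&` [set x | E x.2].

Definition eventually_trivial n (B : nat -> 'I_K -> set R) :=
  forall i a, (n <= i)%N -> B i a = setT.

(** Only the first n rows, hence finitely many entries, are constrained, and the noise lies in an
    arbitrary event. On these sets the model determines the law as a product. *)
Definition cylinders : set (set star) :=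
  [set A | exists B E n, [/\ forall i a, measurable (B i a),
    eventually_trivial n B, measurable E & A = cylinder B E]].

Lemma cylinders_setI : setI_closed cylinders.
Proof.
move=> _ _ [B1 [E1 [n1 [mB1 tB1 mE1 ->]]]] [B2 [E2 [n2 [mB2 tB2 mE2 ->]]]].
exists (fun i a => B1 i a `&` B2 i a), (E1 `&` E2), (maxn n1 n2); split.
- by move=> i a; exact: measurableI.
- by move=> i a; rewrite geq_max => /andP[h1 h2]; rewrite tB1 ?tB2 ?setTI.
- exact: measurableI.
- apply/seteqP; split => x /=.
    by move=> [[h1 e1] [h2 e2]].
  move=> [h [e1 e2]]; split; split => // i a; by have [] := h i a.
Qed.

Lemma cylinders_meas : cylinders `<=` measurable.
Proof.
move=> _ [B [E [n [mB tB mE ->]]]]; apply: measurableI.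
  rewrite (_ : [set _ | _] = \bigcap_i \bigcap_(a : 'I_K)
     ((fun x : star => x.1 i a) @^-1` B i a)).
    apply: bigcapT_measurable => i; apply: fin_bigcap_measurable => // a _.
    by rewrite -[X in measurable X]setTI; exact: measurable_entry.
  by apply/seteqP; split => x /= h i; [move=> _ a _|move=> a]; exact: h.
by rewrite -[X in measurable X]setTI; exact: measurable_star_noise.
Qed.

Lemma cylinders_setT : cylinders setT.
Proof.
exists (fun _ _ => setT), setT, 0%N; split => //.
by apply/seteqP; split.
Qed.

Lemma star_measurable_cylinders : (@measurable _ star) = <<s cylinders >>.
Proof.
apply/seteqP; split; last first.
  by apply: smallest_sub; [exact: sigma_algebra_measurable|exact: cylinders_meas].
rewrite star_measurableE.
apply: smallest_sub; first exact: smallest_sigma_algebra.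
move=> A [mA|mA].
- apply: (smallest_sub _ _ mA) => {A mA}; first exact: smallest_sigma_algebra.
  move=> _ [[i a] _ [B mB <-]]; rewrite setTI; apply: sub_sigma_algebra.
  exists (fun j b => if (j == i) && (b == a) then B else setT), setT, i.+1.
  split => //.
  + by move=> j b; case: ifP.
  + by move=> j b ij; case: eqP => // ji; move: ij; rewrite ji ltnn.
  + apply/seteqP; split => x /=.
      by move=> h; split => // j b; case: ifP => // /andP[/eqP -> /eqP ->].
    by move=> [/(_ i a)]; rewrite !eqxx.
- apply: (smallest_sub _ _ mA) => {A mA}; first exact: smallest_sigma_algebra.
  move=> _ [t _ [B mB <-]]; rewrite setTI; apply: sub_sigma_algebra.
  exists (fun _ _ => setT), [set v | B (v t)], 0%N; split => //.
  + apply: sub_sigma_algebra; exists t => //; exists B => //.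
    by rewrite setTI.
  + by apply/seteqP; split => x //= -[].
Qed.

Lemma star_measure_unique (m1 m2 : {measure set star -> \bar R}) :
  (m1 setT < +oo)%E -> (forall A, cylinders A -> m1 A = m2 A) ->
  forall A, measurable A -> m1 A = m2 A.
Proof.
move=> m1fin m12; apply: (measure_unique cylinders (fun _ => setT)) => //.
- exact: star_measurable_cylinders.
- exact: cylinders_setI.
- by move=> _; exact: cylinders_setT.
- by rewrite bigcup_const //; exists 0%N.
Qed.

End star_space.
Arguments star R {dW} TW K .
Arguments noise {dW} TW .

Section law.
Context {R : realType} {d : measure_display} {Omega : measurableType d}
  {P : probability Omega R} {dW : measure_display} {TW : measurableType dW}
  {K : nat} (Pk : 'I_K -> probability R R)
  (X : nat -> 'I_K -> {RV P >-> R}) (W : nat -> {RV P >-> TW}).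
Hypothesis model : tabular_model Pk X W.

Let S := star R TW K.

Definition realized_star : Omega -> S := realized_data X W.

Lemma measurable_realized_star : measurable_fun setT realized_star.
Proof.
by apply: measurable_to_star => [i a|t]; exact: measurable_funPT.
Qed.
HB.instance Definition _ :=
  isMeasurableFun.Build _ _ _ _ realized_star measurable_realized_star.

Definition star_law : probability S R := distribution P realized_star.

Definition entries_prob (n : nat) (B : nat -> 'I_K -> set R) : \bar R :=
  (\prod_(a < K) \prod_(i < n) Pk a (B i a))%E.

Definition noise_prob (E : set (noise TW)) : \bar R :=
  P ((fun w t => W t w) @^-1` E).

Lemma star_law_cylinder n B E :
  (forall i a, measurable (B i a)) -> eventually_trivial n B -> measurable E ->
  star_law (cylinder B E) = (entries_prob n B * noise_prob E)%E.
Proof.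
move=> mB tB mE; have [distX indepX indepXW] := model.
(* Mutual independence speaks of finite lists without repetition; [s] lists the entries that the
   cylinder constrains. *)
pose s := [seq (i, a) | a <- index_enum 'I_K, i <- index_iota 0 n].
have us : uniq s.
  apply: allpairs_uniq; rewrite ?index_enum_uniq ?iota_uniq //.
  by move=> -[a i] [b j] _ _ [-> ->].
have := indepX s (fun j => B j.1 j.2) us (fun j => mB j.1 j.2).
rewrite big_allpairs_dep /=.
set A1 := \bigcap_(_ in _) _.
have -> : (\big[*%E/1]_(a <- index_enum 'I_K) \big[*%E/1]_(i <- index_iota 0 n)
     P (X i a @^-1` B i a))%E = entries_prob n B.
  rewrite /entries_prob; apply: eq_bigr => a _; rewrite big_mkord.
  by apply: eq_bigr => i _; exact: distX.
move=> <-; rewrite /noise_prob.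
set A2 := _ @^-1` E.
rewrite -indepXW.
- congr (P _); apply/seteqP; split => w /=.
    by move=> [h e]; split => // -[i a] _ /=; exact: h.
  move=> [h e]; split => // i a.
  have [ni|ni] := leqP n i; first by rewrite tB.
  apply: (h (i, a)); apply/allpairsPdep; exists a, i.
  by rewrite mem_index_enum mem_index_iota.
- pose U := g_sigma_algebraType (\bigcup_i preimage_set_system setT
    (fun w => X (i : nat * 'I_K).1 i.2 w) measurable).
  apply: (@fin_bigcap_measurable _ U) => // i _.
  by apply: sub_sigma_algebra; exists i => //; exists (B i.1 i.2) => //; rewrite setTI.
- pose U := g_sigma_algebraType (\bigcup_t preimage_set_system setT
    (fun w => W t w) measurable).
  apply: (@measurable_preimage_g_sigma _ U _ _ (fun w t => W t w : TW) _ E mE).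
  move=> _ [t _ [B' mB' <-]]; rewrite setTI.
  by apply: sub_sigma_algebra; exists t => //; exists B' => //; rewrite setTI.
Qed.


(** * Redrawing a single entry *)

Section resample.
Variables (i : nat) (k : 'I_K).

Definition put_entry (p : S * R) : S := set_entry i k p.2 p.1.

Lemma measurable_put_entry : measurable_fun setT put_entry.
Proof.
apply: measurable_to_star => [j b|t].
  rewrite /put_entry /set_entry /=; case: (_ && _); first exact: measurable_snd.
  exact: (measurableT_comp (@measurable_entry R dW TW K j b) measurable_fst).
exact: (measurableT_comp (@measurable_noise R dW TW K t) measurable_fst).
Qed.
HB.instance Definition _ :=
  isMeasurableFun.Build _ _ _ _ put_entry measurable_put_entry.

Lemma entries_prob_split n B : (i < n)%N ->
  entries_prob n B = (Pk k (B i k) *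
    entries_prob n (fun j b => if (j == i) && (b == k) then setT else B j b))%E.
Proof.
move=> ilen; rewrite /entries_prob (bigD1 k) //= (bigD1 (Ordinal ilen)) //=.
rewrite [in RHS](bigD1 k) //= [in RHS](bigD1 (Ordinal ilen)) //=.
rewrite !eqxx /= probability_setT mul1e -!muleA; congr (_ * (_ * _))%E.
  apply: eq_bigr => j ji; case: ifP => // /andP[/eqP ji' _].
  by move: ji; rewrite -val_eqE /= ji' eqxx.
apply: eq_bigr => b bk; apply: eq_bigr => j _.
by rewrite (negbTE bk) andbF.
Qed.

(** On a cylinder, the constraint on entry (i, k) passes from the table to the fresh draw, and its
    factor [Pk k (B i k)] is the same in either place. *)
Lemma star_law_resample A : measurable A ->
  star_law A = (star_law \x Pk k)%E (put_entry @^-1` A).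
Proof.
move=> mA.
apply: (star_measure_unique (m1 := star_law)
  (m2 := pushforward (star_law \x Pk k)%E put_entry)) mA.
  by rewrite (le_lt_trans (probability_le1 star_law measurableT)) // ltry.
move=> _ [B [E [n [mB tB mE ->]]]].
pose B' j b := if (j == i) && (b == k) then setT else B j b.
have mB' j b : measurable (B' j b) by rewrite /B'; case: ifP.
(* Row i must be among the rows counted, so that its factor can be split off. *)
pose m := maxn n i.+1.
have tBm : eventually_trivial m B.
  by move=> j b; rewrite geq_max => /andP[nj _]; exact: tB.
have tBm' : eventually_trivial m B'.
  by move=> j b mj; rewrite /B'; case: ifP => // _; exact: tBm.
transitivity (entries_prob m B * noise_prob E)%E; first exact: star_law_cylinder.
transitivity ((star_law \x Pk k)%E (put_entry @^-1` cylinder B E)); last by [].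
rewrite (_ : _ @^-1` _ = cylinder B' E `*` B i k); last first.
  apply/seteqP; split => -[x z] /=.
    move=> [h e]; split; last by have := h i k; rewrite /= !eqxx.
    split => // j b; rewrite /B'; have := h j b.
    by rewrite /=; case: ifP.
  move=> [[h e] hz]; split => // j b; have := h j b; rewrite /B' /=.
  by case: ifP => // /andP[/eqP -> /eqP ->].
rewrite product_measure1E //; last by apply: cylinders_meas; exists B', E, m.
transitivity (entries_prob m B' * noise_prob E * Pk k (B i k))%E; last first.
  by congr (_ * _)%E; symmetry; exact: star_law_cylinder.
rewrite (@entries_prob_split m) ?leq_maxr //.
by rewrite -muleA muleC.
Qed.

(** With all other entries frozen, the inner integral is one-dimensional; this is the form to which
    Chebyshev's inequality applies. *)
Lemma integral_resample (f : S -> \bar R) :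
  measurable_fun setT f -> (forall x, (0 <= f x)%E) ->
  (\int[star_law]_x f x =
   \int[star_law]_x \int[Pk k]_z f (set_entry i k z x))%E.
Proof.
move=> mf f0.
transitivity (\int[pushforward (star_law \x Pk k)%E put_entry]_x f x)%E.
  apply: eq_measure_integral => A mA _. exact: star_law_resample.
rewrite ge0_integral_pushforward //.
rewrite preimage_setT fubini_tonelli1 //=.
by apply: measurableT_comp mf _; exact: measurable_put_entry.
Qed.

End resample.

(** * Dropping the first entry of a column *)

Section shift.
Variable k : 'I_K.

Definition shift_arm (x : S) : S :=
  (fun j b => if b == k then x.1 j.+1 b else x.1 j b, x.2).

Lemma measurable_shift_arm : measurable_fun setT shift_arm.
Proof.
apply: measurable_to_star => [j b|t]; last exact: measurable_noise.
by rewrite /shift_arm /=; case: (_ == _); exact: measurable_entry.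
Qed.
HB.instance Definition _ :=
  isMeasurableFun.Build _ _ _ _ shift_arm measurable_shift_arm.

Lemma star_law_shift A : measurable A -> star_law (shift_arm @^-1` A) = star_law A.
Proof.
move=> mA; symmetry.
apply: (star_measure_unique (m1 := star_law)
  (m2 := pushforward star_law shift_arm)) mA.
  by rewrite (le_lt_trans (probability_le1 star_law measurableT)) // ltry.
move=> _ [B [E [n [mB tB mE ->]]]].
pose B' j b := if b == k then (if j is j'.+1 then B j' b else setT) else B j b.
have mB' j b : measurable (B' j b) by rewrite /B'; case: ifP => //; case: j.
have tB' : eventually_trivial n.+1 B'.
  move=> [|j] b // nj; rewrite /B'; case: ifP => _; first exact: tB.
  by rewrite tB // ltnW.
transitivity (entries_prob n B * noise_prob E)%E; first exact: star_law_cylinder.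
transitivity (star_law (shift_arm @^-1` cylinder B E)); last by [].
rewrite (_ : _ @^-1` _ = cylinder B' E); last first.
  apply/seteqP; split => x /= -[h e]; split => // j b; rewrite /B'.
    case: ifP => [bk|bk]; last by have := h j b; rewrite /= bk.
    by case: j => // j; have := h j b; rewrite /= bk.
  have := h j b; have := h j.+1 b; rewrite /B' /=; case: ifP => //.
(* With n+1 rows, column k gains a trivial factor at its top, row 0, while every other column gains
   one at its bottom, row n. *)
rewrite [RHS](_ : _ = entries_prob n.+1 B' * noise_prob E)%E; last first.
  exact: star_law_cylinder.
congr (_ * _)%E; apply: eq_bigr => a _.
have [ak|ak] := eqVneq a k.
  rewrite big_ord_recl /B' /= ak eqxx probability_setT mul1e.
  by apply: eq_bigr => j _.
rewrite big_ord_recr /= /B' (negbTE ak) tB // probability_setT mule1.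
by apply: eq_bigr.
Qed.

End shift.

End law.

(** * The strong law of large numbers for the entries of an arm *)

Section slln.
Context {R : realType} {d : measure_display} {Omega : measurableType d}
  {P : probability Omega R} {dW : measure_display} {TW : measurableType dW}
  {K : nat} (Pk : 'I_K -> probability R R)
  (X : nat -> 'I_K -> {RV P >-> R}) (W : nat -> {RV P >-> TW}).
Hypothesis model : tabular_model Pk X W.

Let S := star R TW K.
Let mu : probability S R := star_law X W.

(** Independence of [E] from the entry is expressed by invariance under overwriting it, so that
    after resampling the indicator of [E] leaves the inner integral. *)
Lemma ge0_integral_entry_indep i k (E : set S) (f : R -> \bar R) :
  measurable E -> (forall z x, E (set_entry i k z x) = E x) ->
  measurable_fun setT f -> (forall z, (0 <= f z)%E) ->
  (\int[mu]_(x in E) f (x.1 i k) = \int[Pk k]_z f z * mu E)%E.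
Proof.
move=> mE invE mf f0.
have mfe : measurable_fun setT (fun x : S => f (x.1 i k)).
  exact: (measurableT_comp mf (@measurable_entry R dW TW K i k)).
have If0 : (0 <= \int[Pk k]_z f z)%E by exact: integral_ge0.
rewrite integral_mkcond (integral_resample model i k); first last.
- by move=> x; rewrite patchE; case: ifP.
- exact/(measurable_restrictT _ mE)/measurable_funTS.
transitivity (\int[mu]_(x in E) (\int[Pk k]_z f z))%E; last first.
  by rewrite integral_cst.
rewrite [RHS]integral_mkcond; apply: eq_integral => x _.
have memE z : (set_entry i k z x \in E) = (x \in E).
  by apply/idP/idP; rewrite !inE invE.
rewrite [RHS]patchE; under eq_integral do rewrite patchE memE /= !eqxx /=.
by case: ifP => // _; rewrite integral0.
Qed.

Lemma integral_entry_indep i k (E : set S) (u : R -> R) :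
  measurable E -> (forall z x, E (set_entry i k z x) = E x) ->
  (Pk k).-integrable setT (EFin \o u) ->
  (\int[mu]_(x in E) (u (x.1 i k))%:E = \int[Pk k]_z (u z)%:E * mu E)%E.
Proof.
move=> mE invE iu; have mu_ := measurable_int _ iu.
rewrite integralE [in RHS]integralE muleBl; first last.
- exact: integrable_add_def.
- exact: fin_num_measure.
rewrite -(@ge0_integral_entry_indep i k E (EFin \o u)^\+%E) //;
  last exact: measurable_funepos.
rewrite -(@ge0_integral_entry_indep i k E (EFin \o u)^\-%E) //;
  last exact: measurable_funeneg.
congr (_ - _)%E; apply: eq_integral => x _.
  by rewrite !funeposE.
by rewrite !funenegE.
Qed.

Lemma integrable_entry i k (u : R -> R) :
  (Pk k).-integrable setT (EFin \o u) ->
  mu.-integrable setT (fun x : S => (u (x.1 i k))%:E).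
Proof.
move=> /integrableP[mu_ fin]; apply/integrableP; split.
  exact: (measurableT_comp mu_ (@measurable_entry R dW TW K i k)).
rewrite (@ge0_integral_entry_indep i k setT (fun z => `|(u z)%:E|)%E) //.
  by rewrite probability_setT mule1.
exact: measurableT_comp.
Qed.

Lemma birkhoff_sum_shift_arm k (u : R -> R) n (x : S) :
  birkhoff_sum (shift_arm k) (fun x : S => u (x.1 0%N k)) n x =
  \sum_(j < n) u (x.1 j k).
Proof.
elim: n x => [|n IH] x; first by rewrite big_ord0.
rewrite /= IH big_ord_recl; congr (_ + _).
by apply: eq_bigr => j _; rewrite /= eqxx.
Qed.

Lemma entry_sum_bounded k (u : R -> R) :
  (Pk k).-integrable setT (EFin \o u) -> (\int[Pk k]_z (u z)%:E < 0)%E ->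
  {ae mu, forall x : S, exists m : nat, forall n,
     \sum_(j < n) u (x.1 j k) <= m%:R}.
Proof.
move=> iu neg.
suff : {ae mu, forall x : S, exists m : nat, forall n,
    birkhoff_sum (shift_arm k) (fun x : S => u (x.1 0%N k)) n x <= m%:R}.
  by apply: filterS => x [m h]; exists m => n; rewrite -birkhoff_sum_shift_arm.
have e0 : (\int[mu]_x (u (x.1 0%N k))%:E = \int[Pk k]_z (u z)%:E)%E.
  by rewrite integral_entry_indep // probability_setT mule1.
apply: birkhoff_sum_bounded.
- exact: measurable_shift_arm.
- by move=> A mA; exact: (star_law_shift model k mA).
- exact: (integrable_entry 0 iu).
(* The shift forgets the entry in row 0, so overwriting that entry does not change membership in an
   event equal to its own preimage. *)
- move=> A mA invA; rewrite e0 integral_entry_indep // => z x.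
  rewrite -[in RHS]invA -[in LHS]invA /preimage /=; congr (A _).
  rewrite /shift_arm /set_entry /=; congr (_, _).
  by apply/funext => j; apply/funext => b; case: (b == k); rewrite ?andbF.
- by rewrite e0.
Qed.

(** Boundedness of partial sums needs a strictly negative mean, hence the slack 1/(m+1) on both
    sides of the mean c; only countably many null sets arise this way. Dividing the bounds by n
    confines the averages to within 1/(m+1) of c in the limit. *)
Lemma strong_law_entries k (u : R -> R) :
  (Pk k).-integrable setT (EFin \o u) ->
  {ae mu, forall x : S,
    n%:R^-1 * \sum_(j < n) u (x.1 j k) @[n --> \oo] -->
    fine (\int[Pk k]_z (u z)%:E)}.
Proof.
move=> iu; set c := fine _.
have cE : (\int[Pk k]_z (u z)%:E = c%:E)%E.
  by rewrite fineK //; exact: integrable_fin_num.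
have icst (e : R) : (Pk k).-integrable setT (EFin \o cst e).
  exact: finite_measure_integrable_cst.
have Icst (e : R) : (\int[Pk k]_z (EFin \o cst e) z = e%:E)%E.
  rewrite [LHS](integral_cst (Pk k) measurableT e%:E) [X in (_ * X)%E](_ : _ = 1%E).
    by rewrite mule1.
  exact: probability_setT.
have up m : {ae mu, forall x : S, exists M : nat, forall n,
     \sum_(j < n) (u (x.1 j k) - (c + m.+1%:R^-1)) <= M%:R}.
  have I : (Pk k).-integrable setT (EFin \o (fun z => u z - (c + m.+1%:R^-1))).
    exact: (integrableB measurableT iu (icst _)).
  apply: (entry_sum_bounded I).
  rewrite (_ : \int[_]_z _ = (- m.+1%:R^-1)%:E)%E ?lte_fin ?oppr_lt0 ?invr_gt0 //.
  under eq_integral do rewrite EFinB.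
  rewrite [LHS](integralB measurableT iu (icst _)) cE Icst.
  by rewrite -EFinB opprD addNKr.
have dn m : {ae mu, forall x : S, exists M : nat, forall n,
     \sum_(j < n) ((c - m.+1%:R^-1) - u (x.1 j k)) <= M%:R}.
  have I : (Pk k).-integrable setT (EFin \o (fun z => (c - m.+1%:R^-1) - u z)).
    exact: (integrableB measurableT (icst _) iu).
  apply: (entry_sum_bounded I).
  rewrite (_ : \int[_]_z _ = (- m.+1%:R^-1)%:E)%E ?lte_fin ?oppr_lt0 ?invr_gt0 //.
  under eq_integral do rewrite EFinB.
  rewrite [LHS](integralB measurableT (icst _) iu) Icst cE.
  by rewrite -EFinB addrAC subrr sub0r.
have := ae_foralln (fun m => up m); have := ae_foralln (fun m => dn m).
apply: filterS2 => x hdn hup.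
apply/cvgrPdist_le => e e0.
(* Half of e pays for the slack, and the other half for the bounds M1 and M2 divided by n. *)
pose m := Num.truncn (2 / e).
have me : m.+1%:R^-1 <= e / 2.
  rewrite -[e / 2]invrK lef_pV2 ?posrE ?invr_gt0 ?divr_gt0 // invf_div.
  by rewrite ltW // truncnS_gt.
have [M1 hM1] := hup m; have [M2 hM2] := hdn m.
exists (Num.truncn ((M1 + M2)%:R * (2 / e))).+1 => // n /= hn.
have n0 : 0 < n%:R :> R by rewrite ltr0n (leq_trans _ hn).
have Mn : (M1 + M2)%:R <= n%:R * (e / 2).
  have : (M1 + M2)%:R * (2 / e) <= n%:R.
    by rewrite (le_trans (ltW (truncnS_gt _))) // ler_nat.
  by rewrite -ler_pdivlMr ?divr_gt0 // invf_div.
have sumE (a : R) : \sum_(j < n) a = n%:R * a by rewrite sumr_const card_ord mulr_natl.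
have := hM1 n; have := hM2 n; rewrite !big_split /= !sumrN !sumE.
have := ler_wpM2l (ltW n0) me; move: Mn n0; rewrite natrD.
have : 0 <= M1%:R :> R by []; have : 0 <= M2%:R :> R by [].
move: (m.+1%:R^-1) (M1%:R) (M2%:R) (n%:R) (\sum_(j < n) _).
move=> dlt A1 A2 N s A20 A10 AN N0 dN h2 h1.
have NV : N * (N^-1 * s) = s by rewrite mulrA divff ?gt_eqF // mul1r.
by rewrite ler_distlC; apply/andP; split; rewrite -(ler_pM2l N0) NV; lra.
Qed.

End slln.

(** * Histories, pull counts and stopped averages *)

(** This serves every quantity read at a random index: the row of the next reward, the stopped time,
    the number of pulls. Only the fibres of the index matter, so [I] carries no sigma-algebra. *)
Lemma measurable_select d d' (S : measurableType d) (U : measurableType d')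
    (I : countType) (c : S -> I) (F : I -> S -> U) :
  (forall i, measurable (c @^-1` [set i])) ->
  (forall i, measurable_fun setT (F i)) ->
  measurable_fun setT (fun x => F (c x) x).
Proof.
move=> mc mF _ Y mY; rewrite setTI.
rewrite (_ : _ @^-1` Y = \bigcup_i (c @^-1` [set i] `&` F i @^-1` Y)).
  apply: countable_bigcupT_measurable => // i; apply: measurableI => //.
  by rewrite -[X in measurable X]setTI; exact: mF.
apply/seteqP; split => x /=; first by exists (c x).
by move=> [i _ [/= <-]].
Qed.

Lemma measurable_preimage_nat d (S : measurableType d) (f : S -> nat) (A : set nat) :
  measurable_fun setT f -> measurable (f @^-1` A).
Proof. by move=> mf; rewrite -[X in measurable X]setTI; exact: mf. Qed.

Lemma cvg_limn_einf_esup (R : realType) (u : nat -> R) (l : R) :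
  u n @[n --> \oo] --> l <->
  limn_einf (EFin \o u) = l%:E /\ limn_esup (EFin \o u) = l%:E.
Proof.
split=> [ul|[il sl]].
  have cu : (EFin \o u) n @[n --> \oo] --> l%:E by apply: cvg_EFin => //; exact: nearW.
  by have [-> ->] := cvg_limn_einf_sup cu.
suff /fine_cvgP[_] : (EFin \o u) n @[n --> \oo] --> l%:E by [].
apply: (@squeeze_cvge _ _ _ _ (einfs (EFin \o u)) _ (esups (EFin \o u))).
- apply: nearW => n; apply/andP; split.
    by apply: ereal_inf_lbound; exists n => //=.
  by apply: ereal_sup_ubound; exists n => //=.
- by rewrite -il limn_einf_lim; exact: is_cvg_einfs.
- by rewrite -sl limn_esup_lim; exact: is_cvg_esups.
Qed.

(** No convergence is assumed: where the sequence diverges, [limn] is the default value [point], and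
    the set of convergence is where the lower and upper limits agree and are finite. *)
Lemma measurable_fun_limn d (S : measurableType d) (R : realType)
    (u : nat -> S -> R) :
  (forall n, measurable_fun setT (u n)) ->
  measurable_fun setT (fun x => limn (u ^~ x)).
Proof.
move=> mu.
pose s x := limn_esup (EFin \o u ^~ x).
pose i x := limn_einf (EFin \o u ^~ x).
have ms : measurable_fun setT s.
  by apply: measurable_fun_limn_esup => n; exact/measurable_EFinP.
have mi : measurable_fun setT i.
  apply: (measurableT_comp (@oppe_measurable R setT)).
  apply: measurable_fun_limn_esup => n; apply: measurableT_comp => //.
  exact/measurable_EFinP.
have E : (fun x => limn (u ^~ x)) =
  (fun x => if (s x == i x) && (s x \is a fin_num) then fine (s x) else point).
  apply/funext => x; case: ifPn => [/andP[/eqP si /fineK sfin]|xD].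
    apply/cvg_lim => //; apply/cvg_limn_einf_esup.
    by rewrite sfin; split; [exact: esym|].
  apply: dvgP; apply: contraNnot xD => /cvg_ex[l /cvg_limn_einf_esup[]].
  by rewrite /s /i => -> ->; rewrite eqxx.
rewrite E; apply: measurable_fun_ifT => //.
- apply: measurable_and.
    apply: (measurable_fun_bool false); rewrite setTI.
    rewrite (_ : _ @^-1` _ = setT `&` [set x | s x != i x]).
      exact: measurable_neqe.
    by rewrite setTI; apply/seteqP; split => x /=; [move=> ->|move/negbTE].
  apply: (measurable_fun_bool true).
  have := emeasurable_fin_num measurableT ms; congr measurable.
- by apply: measurableT_comp ms.
Qed.

Section history.
Context {R : realType} {dW : measure_display} {TW : measurableType dW} {K : nat}.
Variable policy : forall t, hist R TW t -> 'I_K.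
Arguments policy {t} _.
Let S := star R TW K.

Implicit Types (x : S) (k : 'I_K) (t i : nat).

Lemma pullsS k t x : pulls (@policy) k t.+1 x =
  (pulls (@policy) k t x + (policy (history (@policy) x t) == k))%N.
Proof.
by rewrite /pulls /pulls_in /= -cats1 count_cat /= addn0.
Qed.

(** Successive pulls of an arm read its column from the top without gaps, whatever the policy. The
    policy thus enters the averages only through the pull count. *)
Lemma history_sum k (f : R -> R) t x :
  \sum_(o <- (history (@policy) x t).2 | o.1.1 == k :> nat) f o.1.2 =
  \sum_(j < pulls (@policy) k t x) f (x.1 j k).
Proof.
elim: t => [|t IH]; first by rewrite big_nil big_ord0.
rewrite pullsS /= -cats1 big_cat /= IH big_cons big_nil /=.
have [ak|ak] := eqVneq (policy (history (@policy) x t)) k.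
  by rewrite ak eqxx addn1 big_ord_recr /= addr0.
by rewrite val_eqE (negbTE ak) addn0 addr0.
Qed.

Definition entry_avg (f : R -> R) k (n : nat) x : R :=
  n%:R^-1 * \sum_(j < n) f (x.1 j k).

Lemma emp_meanE k f t x :
  emp_mean (@policy) k f t x = entry_avg f k (pulls (@policy) k t x) x.
Proof. by rewrite /emp_mean history_sum. Qed.

Lemma emp_cdfE k y t x :
  emp_cdf (@policy) k y t x = emp_mean (@policy) k (fun z => (z <= y)%R%:R) t x.
Proof.
rewrite /emp_cdf /emp_mean; congr (_ * _).
elim: (tval _) => [|o s IH] /=; first by rewrite big_nil.
rewrite natrD IH big_cons; case: ifP => _ //=.
by rewrite add0r.
Qed.

Lemma leq_pulls k x : {homo (pulls (@policy) k)^~ x : s t / (s <= t)%N}.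
Proof.
apply: homo_leq => [//|? ? ?|t]; first exact: leq_trans.
by rewrite pullsS leq_addr.
Qed.

(** Rows are numbered from 0, so i pulls read rows 0 to i-1 and leave entry i unseen. *)
Lemma history_set_entry i k z t x : (pulls (@policy) k t x <= i)%N ->
  history (@policy) (set_entry i k z x) t = history (@policy) x t.
Proof.
elim: t => [|t IH] //; rewrite pullsS => ti.
have /IH /= -> : (pulls (@policy) k t x <= i)%N by rewrite (leq_trans _ ti) ?leq_addr.
congr (_, _); apply: val_inj => /=; congr (rcons _ (_, _, _)).
case: ifP => // /andP[/eqP ei /eqP ek].
(* Reading row i at this step would bring the count to i+1. *)
move: ti; rewrite -ei /= {1}/pulls -ek eqxx addn1.
by rewrite ek ltnn.
Qed.

Section stopped.
Variable T : S -> option nat.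
Hypothesis T_stop : stopping_time (@policy) T.

Definition stopped_count k t x : nat := pulls (@policy) k (time_min (T x) t) x.

Lemma time_min_homo o : {homo time_min o : s t / (s <= t)%N}.
Proof. by case: o => [n|] s t st //=; rewrite leq_min geq_minl geq_min st orbT. Qed.

Lemma leq_stopped_count k x : {homo (stopped_count k)^~ x : s t / (s <= t)%N}.
Proof. by move=> s t st; apply: leq_pulls; exact: time_min_homo. Qed.

(** The event that T is at most t is a preimage under the history at t, so it contains both points
    or neither. *)
Lemma time_le_history t x x' :
  history (@policy) x t = history (@policy) x' t -> time_le T t x -> time_le T t x'.
Proof.
move=> hxx' Tx; have [B mB defB] := T_stop t.
by move: Tx; rewrite -defB => -[_ Bx]; split => //=; rewrite -hxx'.
Qed.

Lemma stopped_count_set_entry i k z x :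
  (forall t, stopped_count k t x <= i)%N ->
  forall t, stopped_count k t (set_entry i k z x) = stopped_count k t x.
Proof.
move=> Ni.
have eqh t : (if T x is Some n then t <= n else true)%N ->
    history (@policy) (set_entry i k z x) t = history (@policy) x t.
  move=> tT; apply: history_set_entry; have := Ni t; rewrite /stopped_count.
  by case: (T x) tT => [n tn|_] //=; rewrite (minn_idPr tn).
(* The histories agree up to T x, so the modified table stops no later; they then agree at its
   stopping time as well, so it stops no earlier. If T x is infinite, they agree at all times. *)
have eqT : T (set_entry i k z x) = T x.
  case Tx : (T x) eqh => [n|] eqh.
    have : time_le T n (set_entry i k z x).
      by apply: (@time_le_history n x); [rewrite eqh|rewrite /time_le /= Tx].
    case Tx' : (T (set_entry i k z x)) => [n'|]; rewrite /time_le /= Tx' // => n'n.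
    have : time_le T n' x.
      by apply: (time_le_history (eqh n' n'n)); rewrite /time_le /= Tx'.
    by rewrite /time_le /= Tx => nn'; congr Some; apply/eqP; rewrite eqn_leq n'n.
  case Tx' : (T (set_entry i k z x)) => [n'|] //.
  have : time_le T n' x.
    by apply: (time_le_history (eqh n' isT)); rewrite /time_le /= Tx'.
  by rewrite /time_le /= Tx.
move=> t; rewrite /stopped_count eqT /pulls eqh //.
by case: (T x) => //= n; exact: geq_minl.
Qed.

Definition entry_read i k x : Prop := exists t, (i < stopped_count k t x)%N.

Lemma set_entry_set_entry i k z z' x :
  set_entry i k z (set_entry i k z' x) = set_entry i k z x.
Proof.
rewrite /set_entry /=; congr (_, _); apply/funext => j; apply/funext => b.
by case: (_ && _).
Qed.

Lemma set_entry_id i k x : set_entry i k (x.1 i k) x = x.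
Proof.
case: x => x w; rewrite /set_entry /=; congr (_, _).
apply/funext => j; apply/funext => b.
by case: ifP => // /andP[/eqP -> /eqP ->].
Qed.

(* Whether entry [i] is ever read is decided before its value is seen. *)
Lemma entry_read_set_entry i k z x :
  entry_read i k (set_entry i k z x) <-> entry_read i k x.
Proof.
(* One implication is enough, because an overwritten entry can be restored. If entry i is unread,
   all stopped counts are at most i, and overwriting it leaves them unchanged. *)
suff H z' x' : entry_read i k (set_entry i k z' x') -> entry_read i k x'.
  split; first exact: H.
  by rewrite -{1}[x](set_entry_id i k) -(set_entry_set_entry i k _ z); exact: H.
move=> [t it]; apply: contrapT => nr.
have N t' : (stopped_count k t' x' <= i)%N.
  by rewrite leqNgt; apply/negP => it'; apply: nr; exists t'.
by move: it; rewrite stopped_count_set_entry // ltnNge N.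
Qed.

(* [N_k(T)], with [None] for infinity. *)
Definition total_pulls k x : option nat :=
  if pselect (exists n, exists t0, forall t, (t0 <= t)%N -> stopped_count k t x = n)
    is left h then Some (projT1 (cid h)) else None.

Lemma total_pulls_some k x n : total_pulls k x = Some n <->
  exists t0, forall t, (t0 <= t)%N -> stopped_count k t x = n.
Proof.
rewrite /total_pulls; case: pselect => [h|h]; last first.
  by split => // n_; exfalso; apply: h; exists n.
have [t0 h0] := projT2 (cid h).
split => [[<-]|[t1 h1]]; first by exists t0.
by rewrite -(h1 (maxn t0 t1)) ?leq_maxr // h0 ?leq_maxl.
Qed.

Lemma total_pulls_none k x : total_pulls k x = None ->
  forall i, exists t0, forall t, (t0 <= t)%N -> (i < stopped_count k t x)%N.
Proof.
move=> N i.
suff [t0 h] : exists t, (i < stopped_count k t x)%N.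
  by exists t0 => t /(leq_stopped_count k x); exact: leq_trans.
elim: i => [|i [t0 h0]].
  apply: contrapT => h; suff : total_pulls k x = Some 0%N by rewrite N.
  apply/total_pulls_some; exists 0%N => t _; apply/eqP; rewrite -leqn0 leqNgt.
  by apply/negP => h'; apply: h; exists t.
apply: contrapT => h; suff : total_pulls k x = Some i.+1 by rewrite N.
apply/total_pulls_some; exists t0 => t tt0; apply/eqP; rewrite eqn_leq.
rewrite (leq_trans h0) ?leq_stopped_count // andbT leqNgt.
by apply/negP => h'; apply: h; exists t.
Qed.

Lemma entry_readE i k x : entry_read i k x <->
  if total_pulls k x is Some n then (i < n)%N else true.
Proof.
case E : (total_pulls k x) => [n|]; last first.
  by split => // _; have [t0 h] := total_pulls_none E i; exists t0; exact: h.
have [t0 h0] := (total_pulls_some k x n).1 E.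
split => [[t it]|ni]; last by exists t0; rewrite h0.
rewrite (leq_trans it) // -(h0 (maxn t t0)) ?leq_maxr //.
by rewrite leq_stopped_count // leq_maxl.
Qed.

Lemma stopped_pullsE k x : stopped_pulls (@policy) T k x =
  if total_pulls k x is Some n then n%:R%:E else +oo%E.
Proof.
apply/cvg_lim => //; case E : (total_pulls k x) => [n|].
  have [t0 h0] := (total_pulls_some k x n).1 E.
  by apply: cvg_near_cst; exists t0 => // t /= tt0; rewrite -(h0 t tt0).
apply/cvgeyPge => A; have [t0 h0] := total_pulls_none E (Num.truncn A).
exists t0 => // t /= /h0 tA; rewrite lee_fin.
by apply: (le_trans (ltW (truncnS_gt A))); rewrite ler_nat.
Qed.

(** The stopped averages are the column averages read along the stopped count, which either becomes
    constant or tends to infinity. *)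
Lemma stopped_emp_mean_cvg k f x (c : R) :
  (entry_avg f k n x @[n --> \oo] --> c) ->
  stopped_emp_mean (@policy) T k f x =
    if total_pulls k x is Some n then entry_avg f k n x else c.
Proof.
move=> fc; apply/cvg_lim => //; case E : (total_pulls k x) => [n|].
  have [t0 h0] := (total_pulls_some k x n).1 E.
  by apply: cvg_near_cst; exists t0 => // t /= tt0; rewrite emp_meanE -(h0 t tt0).
under eq_fun do rewrite emp_meanE.
apply: (cvg_comp (stopped_count k ^~ x) (fun n => entry_avg f k n x)) fc.
by apply/cvgnyPgt => A; have [t0 h0] := total_pulls_none E A; exists t0.
Qed.

End stopped.
End history.

(** * Measurability of histories and stopped quantities *)

Section measurability.
Context {R : realType} {dW : measure_display} {TW : measurableType dW} {K : nat}.
Variable policy : forall t, hist R TW t -> 'I_K.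
Arguments policy {t} _.
Hypothesis policy_meas : measurable_policy (@policy).
Let S := star R TW K.
Implicit Types (x : S) (k : 'I_K) (t i : nat).

Let measurable_next t (a : 'I_K) :
  measurable_fun setT (fun x : S => history (@policy) x t) ->
  measurable ((fun x : S => policy (history (@policy) x t)) @^-1` [set a]).
Proof.
move=> mh; rewrite -[X in measurable X]setTI.
exact: (mh measurableT _ (policy_meas a)).
Qed.

(** The two claims are proved together: the next reward is read at a row given by a pull count, and
    the next pull count depends on the arm chosen from the history. *)
Lemma measurable_history_pulls t :
  measurable_fun setT (fun x : S => history (@policy) x t) /\
  forall k, measurable_fun setT (pulls (@policy) k t : S -> nat).
Proof.
elim: t => [|t [mh mp]].
  split; last by move=> k; exact: measurable_cst.
  apply: measurable_fun_pair; first exact: (@measurable_noise R dW TW K).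
  exact: measurable_cst.
split; last first.
  move=> k; rewrite (_ : pulls _ k t.+1 = fun x : S =>
      pulls (@policy) k t x + (policy (history (@policy) x t) == k))%N; last first.
    by apply/funext => x; rewrite pullsS.
  apply: measurable_fun_addn => //.
  apply: (measurableT_comp (f := nat_of_bool)) => //.
  apply: (measurable_fun_bool true); rewrite setTI.
  rewrite (_ : _ @^-1` _ = (fun x : S => policy (history (@policy) x t)) @^-1` [set k]).
    exact: measurable_next.
  by apply/seteqP; split => x /= /eqP.
apply: measurable_fun_pair => /=.
  exact: (measurableT_comp measurable_fst mh).
pose F (a : 'I_K) x := (a : nat, x.1 (pulls (@policy) a t x) a, x.2 t.+1).
have mF a : measurable_fun setT (F a).
  apply: measurable_fun_pair; last exact: (@measurable_noise R dW TW K).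
  apply: measurable_fun_pair; first exact: measurable_cst.
  apply: (@measurable_select _ _ S R nat (pulls (@policy) a t)
    (fun i (x : S) => x.1 i a)).
    by move=> i; exact: measurable_preimage_nat.
  by move=> i; exact: (@measurable_entry R dW TW K).
apply/measurable_fun_tnthP => i.
have [it|it] := ltnP i t.
  rewrite (_ : _ \o _ = fun x => tnth (history (@policy) x t).2 (Ordinal it)).
    apply: (measurableT_comp (measurable_tnth (Ordinal it))).
    exact: (measurableT_comp measurable_snd mh).
  apply/funext => x /=; rewrite (tnth_nth (0%N, 0, x.2 0%N)) /=.
  by rewrite (tnth_nth (0%N, 0, x.2 0%N)) nth_rcons size_tuple it.
rewrite (_ : _ \o _ = fun x => F (policy (history (@policy) x t)) x).
  by apply: measurable_select => // a; exact: measurable_next.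
apply/funext => x /=; rewrite (tnth_nth (0%N, 0, x.2 0%N)) /=.
rewrite nth_rcons size_tuple ltnNge it /= eqn_leq it.
by have := ltn_ord i; rewrite ltnS => ->.
Qed.

Section stopped.
Variable T : S -> option nat.
Hypothesis T_stop : stopping_time (@policy) T.

Lemma measurable_time_le t : measurable (time_le T t : set S).
Proof.
have [B mB <-] := T_stop t.
by have [mh _] := measurable_history_pulls t; exact: mh.
Qed.

Lemma measurable_time_min t : measurable_fun setT (fun x => time_min (T x) t).
Proof.
elim: t => [|t IH].
  rewrite (_ : (fun _ => _) = cst 0%N); first exact: measurable_cst.
  by apply/funext => x; case: (T x) => [n|] //=; rewrite min0n.
(* Passing from t to t+1 raises min(T, t) by one exactly when T > t. *)
rewrite (_ : (fun _ => _) =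
    (fun x => time_min (T x) t + nat_of_bool (x \in ~` time_le T t))%N).
  apply: measurable_fun_addn => //.
  apply: (measurableT_comp (f := nat_of_bool)) => //.
  apply: (measurable_fun_bool true); rewrite setTI.
  rewrite (_ : _ @^-1` _ = ~` time_le T t).
    by apply: measurableC; exact: measurable_time_le.
  by apply/seteqP; split => x /=; [exact: set_mem|exact: mem_set].
apply/funext => x; have [Tx|Tx] := boolP (x \in ~` time_le T t); move: Tx.
  rewrite inE /time_le /=; case: (T x) => [n|] /=; last by rewrite addn1.
  move/negP; rewrite -ltnNge => tn.
  by rewrite (minn_idPr tn) (minn_idPr (ltnW tn)) addn1.
rewrite notin_setE /time_le /= => /contrapT; case: (T x) => [n|] //= nt.
by rewrite (minn_idPl nt) (minn_idPl (leqW nt)) addn0.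
Qed.

Lemma measurable_stopped_count k t :
  measurable_fun setT (stopped_count (@policy) T k t).
Proof.
apply: (measurable_select (c := fun x => time_min (T x) t)
  (F := fun t x => pulls (@policy) k t x)).
  by move=> i; apply: measurable_preimage_nat; exact: measurable_time_min.
by move=> i; have [_] := measurable_history_pulls i.
Qed.

Lemma measurable_entry_avg (f : R -> R) k n : measurable_fun setT f ->
  measurable_fun setT (entry_avg f k n : S -> R).
Proof.
move=> mf; apply: measurable_funM; first exact: measurable_cst.
apply: measurable_sum => j.
exact: (measurableT_comp mf (@measurable_entry R dW TW K j k)).
Qed.

Lemma measurable_stopped_emp_mean f k : measurable_fun setT f ->
  measurable_fun setT (stopped_emp_mean (@policy) T k f : S -> R).
Proof.
move=> mf; apply: measurable_fun_limn => t.
rewrite (_ : (fun _ => _) = fun x => entry_avg f k (stopped_count (@policy) T k t x) x).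
  apply: (measurable_select (c := stopped_count (@policy) T k t)
    (F := fun n x => entry_avg f k n x)).
    by move=> i; apply: measurable_preimage_nat; exact: measurable_stopped_count.
  by move=> i; exact: measurable_entry_avg.
by apply/funext => x; rewrite emp_meanE.
Qed.

Lemma measurable_total_pulls k o :
  measurable (total_pulls (@policy) T k @^-1` [set o] : set S).
Proof.
have mSome n : measurable (total_pulls (@policy) T k @^-1` [set Some n] : set S).
  rewrite (_ : _ @^-1` _ = \bigcup_t0 \bigcap_(t in [set t | (t0 <= t)%N])
      (stopped_count (@policy) T k t @^-1` [set n])).
    apply: bigcupT_measurable => t0; apply: bigcap_measurableType => t _.
    by apply: measurable_preimage_nat; exact: measurable_stopped_count.
  apply/seteqP; split => x /=.
    by move=> /total_pulls_some[t0 h]; exists t0.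
  by move=> [t0 _ h]; apply/total_pulls_some; exists t0.
case: o => // ; rewrite (_ : _ @^-1` _ =
  ~` \bigcup_n (total_pulls (@policy) T k @^-1` [set Some n])).
  by apply: measurableC; apply: bigcupT_measurable.
apply/seteqP; split => x /=; first by move=> e [n _] /=; rewrite e.
by case E : (total_pulls _ _ _ x) => [n|] // h; exfalso; apply: h; exists n.
Qed.

End stopped.
End measurability.

(** * Comparison with the mean *)

(* Integrate [(u x - u y) * (h x - h y)] in both variables. *)
Lemma chebyshev_integral d (S : measurableType d) (R : realType)
    (Q : probability S R) (u h : S -> R) :
  Q.-integrable setT (EFin \o u) -> Q.-integrable setT (EFin \o h) ->
  Q.-integrable setT (EFin \o (u \* h)) ->
  (forall x y, 0 <= (u x - u y) * (h x - h y)) ->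
  (\int[Q]_x u x) * (\int[Q]_x h x) <= \int[Q]_x (u x * h x).
Proof.
move=> iu ih iuh uh0.
set a := \int[Q]_x u x; set b := \int[Q]_x h x; set c := \int[Q]_x (u x * h x).
have icst (e : R) : Q.-integrable setT (EFin \o cst e).
  exact: finite_measure_integrable_cst.
have Icst (e : R) : \int[Q]_x (cst e) x = e.
  rewrite Rintegral_cst // [X in _ * fine X](_ : _ = 1%E) ?mulr1 //.
  exact: probability_setT.
have iZ (e : R) f : Q.-integrable setT (EFin \o f) ->
    Q.-integrable setT (EFin \o (fun x => e * f x)).
  by move=> fi; exact: (integrableZl measurableT e fi).
have iD f g : Q.-integrable setT (EFin \o f) -> Q.-integrable setT (EFin \o g) ->
    Q.-integrable setT (EFin \o (fun x => f x + g x)).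
  by move=> fi gi; exact: (integrableD measurableT fi gi).
have iB f g : Q.-integrable setT (EFin \o f) -> Q.-integrable setT (EFin \o g) ->
    Q.-integrable setT (EFin \o (fun x => f x - g x)).
  by move=> fi gi; exact: (integrableB measurableT fi gi).
(* This is the integral in x with y frozen; integrating it in y gives 2 (c - a b). *)
have step y : 0 <= c - h y * a - (u y * b - u y * h y).
  have := @Rintegral_ge0 _ _ _ Q setT (fun x => (u x - u y) * (h x - h y))
    (fun x _ => uh0 x y).
  rewrite (_ : (fun x => _) =
      fun x => (u x * h x - h y * u x) - (u y * h x - cst (u y * h y) x)); last first.
    by apply/funext => x /=; ring.
  rewrite RintegralB ?RintegralB ?RintegralZl ?Icst //;
    do ?[exact: iZ|exact: icst|by apply: iB => //; first [exact: iZ|exact: icst]].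
have := @Rintegral_ge0 _ _ _ Q setT (fun y => c - h y * a - (u y * b - u y * h y))
  (fun y _ => step y).
rewrite (_ : (fun x => _) =
    fun x => (cst c x - a * h x) - (b * u x - u x * h x)); last first.
  by apply/funext => x /=; ring.
rewrite RintegralB ?RintegralB ?RintegralZl ?Icst //;
    do ?[exact: iZ|exact: icst|by apply: iB => //; first [exact: iZ|exact: icst]].
rewrite -/a -/b -/c; lra.
Qed.

Lemma chebyshev_integral_anti d (S : measurableType d) (R : realType)
    (Q : probability S R) (u h : S -> R) :
  Q.-integrable setT (EFin \o u) -> Q.-integrable setT (EFin \o h) ->
  Q.-integrable setT (EFin \o (u \* h)) ->
  (forall x y, (u x - u y) * (h x - h y) <= 0) ->
  \int[Q]_x (u x * h x) <= (\int[Q]_x u x) * (\int[Q]_x h x).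
Proof.
move=> iu ih iuh uh0.
have iN f : Q.-integrable setT (EFin \o f) ->
    Q.-integrable setT (EFin \o (fun x => -1 * f x)).
  by move=> fi; exact: (integrableZl measurableT (-1) fi).
have iuN : Q.-integrable setT (EFin \o (u \* (fun x => -1 * h x))).
  rewrite (_ : _ \* _ = fun x => -1 * (u x * h x)); first exact: iN.
  by apply/funext => x /=; rewrite mulrCA.
have E : \int[Q]_x (u x * (-1 * h x)) = -1 * \int[Q]_x (u x * h x).
  by rewrite -RintegralZl //; apply: eq_Rintegral => x _; rewrite mulrCA.
have := chebyshev_integral iu (iN _ ih) iuN; rewrite E RintegralZl //.
rewrite mulrCA !mulN1r lerN2; apply=> x y.
by have := uh0 x y; lra.
Qed.

Section core.
Context {R : realType} {d : measure_display} {Omega : measurableType d}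
  {P : probability Omega R} {dW : measure_display} {TW : measurableType dW}
  {K : nat} (Pk : 'I_K -> probability R R)
  (X : nat -> 'I_K -> {RV P >-> R}) (W : nat -> {RV P >-> TW}).
Hypothesis model : tabular_model Pk X W.
Variable policy : forall t, hist R TW t -> 'I_K.
Arguments policy {t} _.
Hypothesis policy_meas : measurable_policy (@policy).
Let S := star R TW K.
Let mu : probability S R := star_law X W.
Variables (T : S -> option nat) (k : 'I_K) (C : set S).
Hypothesis T_stop : stopping_time (@policy) T.
Hypothesis mC : measurable C.

Local Notation N := (total_pulls (@policy) T k).

Definition entry_weight (i : nat) (x : S) : R :=
  if N x is Some n then if (i < n)%N then \1_C x / n%:R else 0 else 0.

Lemma entry_weight_ge0 i x : 0 <= entry_weight i x.
Proof.
by rewrite /entry_weight; case: (N x) => // n; case: ifP.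
Qed.

Lemma entry_weight_le1 i x : entry_weight i x <= 1.
Proof.
rewrite /entry_weight; case: (N x) => [[|n]|] //; case: ifP => // _.
rewrite ler_pdivrMr // mul1r indicE.
by case: (_ \in _); rewrite ?ler0n // ler1n.
Qed.

Lemma measurable_entry_weight i : measurable_fun setT (entry_weight i).
Proof.
apply: (@measurable_select _ _ S R _ N (fun o x =>
  if o is Some n then if (i < n)%N then \1_C x / n%:R else 0 else 0)).
  by move=> o; exact: measurable_total_pulls.
move=> [n|]; last exact: measurable_cst.
case: (_ < _)%N; last exact: measurable_cst.
by apply: measurable_funM; [exact: measurable_indic|exact: measurable_cst].
Qed.

(** A read entry forces N >= 1, which excludes the value +oo that [weight] takes on C when N = 0. If
    N is infinite, both sides vanish. *)
Lemma entry_weightE i x : entry_read (@policy) T i k x ->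
  (entry_weight i x)%:E = weight (@policy) T C k x.
Proof.
move=> /entry_readE; rewrite /entry_weight /weight stopped_pullsE.
case: (N x) => [n|_]; last by rewrite invey mule0.
move=> ni; rewrite ni inver pnatr_eq0 gtn_eqF ?EFinM //.
exact: leq_ltn_trans ni.
Qed.

Lemma entry_weight_unread i x : ~ entry_read (@policy) T i k x ->
  entry_weight i x = 0.
Proof.
move=> h; rewrite /entry_weight; case E : (N x) => [n|] //; case: ifP => // ni.
by exfalso; apply: h; apply/entry_readE; rewrite E.
Qed.

Lemma entry_weight_decreasing i x z z' :
  decreasing_in_entry i k (weight (@policy) T C k) -> z <= z' ->
  entry_weight i (set_entry i k z' x) <= entry_weight i (set_entry i k z x).
Proof.
move=> h zz'; have [r|r] := pselect (entry_read (@policy) T i k x).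
  by rewrite -lee_fin !entry_weightE ?entry_read_set_entry //; exact: h.
by rewrite !entry_weight_unread // entry_read_set_entry.
Qed.

Lemma entry_weight_increasing i x z z' :
  increasing_in_entry i k (weight (@policy) T C k) -> z <= z' ->
  entry_weight i (set_entry i k z x) <= entry_weight i (set_entry i k z' x).
Proof.
move=> h zz'; have [r|r] := pselect (entry_read (@policy) T i k x).
  by rewrite -lee_fin !entry_weightE ?entry_read_set_entry //; exact: h.
by rewrite !entry_weight_unread // entry_read_set_entry.
Qed.

(** This is the stopped empirical mean with its limit on N = oo replaced by the almost sure value.
    For integrable functions it respects differences and order at every point. *)
Definition avg_or_mean (u : R -> R) (x : S) : R :=
  if N x is Some n then entry_avg u k n x else fine (\int[Pk k]_z (u z)%:E)%E.

Lemma measurable_avg_or_mean (u : R -> R) : measurable_fun setT u ->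
  measurable_fun setT (avg_or_mean u).
Proof.
move=> mu_; apply: (@measurable_select _ _ S R _ N (fun o x =>
  if o is Some n then entry_avg u k n x else fine (\int[Pk k]_z (u z)%:E)%E)).
  by move=> o; exact: measurable_total_pulls.
by move=> [n|]; [exact: measurable_entry_avg|exact: measurable_cst].
Qed.

Lemma eq_stopped_emp_mean (u : R -> R) : (Pk k).-integrable setT (EFin \o u) ->
  {ae mu, forall x, stopped_emp_mean (@policy) T k u x = avg_or_mean u x}.
Proof.
move=> iu; have := strong_law_entries model iu.
by apply: filterS => x; exact: stopped_emp_mean_cvg.
Qed.

Lemma avg_or_mean_ge0 u x : (forall z, 0 <= u z) -> 0 <= avg_or_mean u x.
Proof.
move=> u0; rewrite /avg_or_mean; case: (N x) => [n|].
  by rewrite mulr_ge0 // sumr_ge0.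
by apply: fine_ge0; apply: integral_ge0 => z _; rewrite lee_fin.
Qed.

Let cst1_int : (\int[Pk k]_z 1%:E = 1 :> \bar R)%E.
Proof.
rewrite [LHS](integral_cst (Pk k) measurableT 1%E) mul1e.
exact: probability_setT.
Qed.

Lemma eseries_entry_weight u x : (forall z, 0 <= u z) ->
  (\sum_(i <oo) (u (x.1 i k) * entry_weight i x)%:E +
   (fine (\int[Pk k]_z (u z)%:E)%E * \1_(C `&` N @^-1` [set None]) x)%:E =
   (avg_or_mean u x * \1_C x)%:E)%E.
Proof.
move=> u0; rewrite indicI /= !indicE /avg_or_mean /entry_weight.
case E : (N x) => [n|]; last first.
  rewrite [X in (X + _)%E]eseries0; last by move=> i _ _; rewrite mulr0.
  have -> : x \in N @^-1` [set None] by exact: mem_set.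
  by rewrite add0e mulr1.
have -> : (x \in N @^-1` [set None]) = false by apply: memNset; rewrite /= E.
rewrite !mulr0 adde0; apply/cvg_lim => //; apply: cvg_near_cst.
exists n => // m /= nm; rewrite (big_cat_nat (n := n)) //=.
rewrite [X in (_ + X)%E]big_nat_cond [X in (_ + X)%E]big1 ?adde0; last first.
  by move=> i; rewrite andbT => /andP[ni _]; rewrite ltnNge ni mulr0.
rewrite big_mkord sumEFin; congr EFin; rewrite /entry_avg -mulrA mulr_suml mulr_sumr.
by apply: eq_bigr => i _; rewrite ltn_ord indicE [RHS]mulrC mulrA.
Qed.

(** Nonnegativity of [u] is what permits integrating the series over entries term by term. *)
Lemma integral_avg_or_mean (u : R -> R) : measurable_fun setT u -> (forall z, 0 <= u z) ->
  (\int[mu]_(x in C) (avg_or_mean u x)%:E =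
   \sum_(i <oo) \int[mu]_x (u (x.1 i k) * entry_weight i x)%:E +
   (fine (\int[Pk k]_z (u z)%:E))%:E * mu (C `&` N @^-1` [set None]))%E.
Proof.
move=> mu_ u0.
have mterm i : measurable_fun setT (fun x : S => (u (x.1 i k) * entry_weight i x)%:E).
  apply/measurable_EFinP; apply: measurable_funM; last exact: measurable_entry_weight.
  exact: (measurableT_comp mu_ (@measurable_entry R dW TW K i k)).
have term0 i x : (0 <= (u (x.1 i k) * entry_weight i x)%:E)%E.
  by rewrite lee_fin mulr_ge0 // entry_weight_ge0.
have c0 : 0 <= fine (\int[Pk k]_z (u z)%:E)%E.
  by apply: fine_ge0; apply: integral_ge0 => z _; rewrite lee_fin.
have mNone : measurable (C `&` N @^-1` [set None]).
  by apply: measurableI => //; exact: measurable_total_pulls.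
rewrite integral_mkcond.
transitivity (\int[mu]_x (\sum_(i <oo) (u (x.1 i k) * entry_weight i x)%:E +
   (fine (\int[Pk k]_z (u z)%:E)%E * \1_(C `&` N @^-1` [set None]) x)%:E))%E.
  apply: eq_integral => x _; rewrite eseries_entry_weight // patchE indicE.
  by case: (x \in C); rewrite ?mulr1 ?mulr0.
rewrite ge0_integralD //.
- rewrite integral_nneseries //; congr (_ + _)%E.
  under eq_integral do rewrite EFinM.
  rewrite ge0_integralZl_EFin //; last first.
    by apply/measurable_EFinP; exact: measurable_indic.
  by rewrite integral_indic // setIT.
- by move=> x _; apply: nneseries_ge0.
- exact: ge0_emeasurable_sum.
- by move=> x _; rewrite lee_fin mulr_ge0 // indicE.
- by apply/measurable_EFinP; apply: measurable_funM => //; exact: measurable_indic.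
Qed.


(** Here N >= 1 enters: the average of the constant 1 over an empty sample would be 0. *)
Lemma integral_avg_or_mean1 :
  {ae mu, forall x, (1 <= stopped_pulls (@policy) T k x)%E} ->
  (\int[mu]_(x in C) (avg_or_mean (cst 1) x)%:E = mu C)%E.
Proof.
move=> N1; rewrite -[RHS]mul1e -(integral_cst mu mC 1%E).
apply: ge0_ae_eq_integral => //.
- apply: measurable_funTS; apply/measurable_EFinP.
  by apply: measurable_avg_or_mean; exact: measurable_cst.
- by move=> x _; rewrite lee_fin avg_or_mean_ge0.
- apply: (@filterS _ (almost_everywhere mu) _ _ _ _ N1) => x.
  rewrite stopped_pullsE /avg_or_mean.
  case: (N x) => [n|_ _] /=; last by rewrite cst1_int.
  rewrite lee_fin ler1n => n0 _; rewrite /entry_avg sumr_const card_ord.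
  by rewrite mulVf // pnatr_eq0 -lt0n.
Qed.

(** * Comparison for nonnegative functions *)

Section compare.
Variable u : R -> R.
Hypotheses (u_ge0 : forall z, 0 <= u z)
  (u_int : (Pk k).-integrable setT (EFin \o u)).
Let mu_u : measurable_fun setT u.
Proof. by apply/measurable_EFinP; exact: (measurable_int (Pk k)). Qed.

Let mean_ge0 : 0 <= \int[Pk k]_z u z.
Proof. exact: Rintegral_ge0. Qed.

Let m_section i x : measurable_fun setT
  (fun z => entry_weight i (set_entry i k z x)).
Proof.
have mput := measurableT_comp (@measurable_put_entry R dW TW K i k)
  (@pair1_measurable _ _ S R x).
exact: (measurableT_comp (measurable_entry_weight i) mput).
Qed.

Let weight_int i x : (Pk k).-integrable setT
  (fun z => (entry_weight i (set_entry i k z x))%:E).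
Proof.
apply: (@le_integrable _ _ _ _ _ _ _ (EFin \o cst 1)) => //.
- by apply/measurable_EFinP; exact: (m_section i x).
- move=> z _; rewrite /= lee_fin normr1 ger0_norm ?entry_weight_ge0 //.
  exact: entry_weight_le1.
- exact: finite_measure_integrable_cst.
Qed.

Let prod_int i x : (Pk k).-integrable setT
  (fun z => (u z * entry_weight i (set_entry i k z x))%:E).
Proof.
apply: (@le_integrable _ _ _ _ _ _ _ (EFin \o u)) => //.
- by apply/measurable_EFinP; apply: measurable_funM => //; exact: (m_section i x).
- move=> z _; rewrite /= lee_fin normrM (ger0_norm (entry_weight_ge0 _ _)).
  by rewrite ler_piMr // entry_weight_le1.
Qed.

Let m_mean i : measurable_fun setT
  (fun x : S => \int[Pk k]_z (entry_weight i (set_entry i k z x))%:E)%E.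
Proof.
apply: (@measurable_fun_fubini_tonelli_F _ _ S R R (Pk k)
  (fun p : S * R => (entry_weight i (put_entry i k p))%:E)).
  apply/measurable_EFinP; apply: (measurableT_comp (measurable_entry_weight i)).
  exact: measurable_put_entry.
by move=> p; rewrite lee_fin entry_weight_ge0.
Qed.

Let m_prod i : measurable_fun setT
  (fun x : S => \int[Pk k]_z (u z * entry_weight i (set_entry i k z x))%:E)%E.
Proof.
apply: (@measurable_fun_fubini_tonelli_F _ _ S R R (Pk k)
  (fun p : S * R => (u p.2 * entry_weight i (put_entry i k p))%:E)).
  apply/measurable_EFinP; apply: measurable_funM.
    exact: (measurableT_comp mu_u measurable_snd).
  apply: (measurableT_comp (measurable_entry_weight i)).
  exact: measurable_put_entry.
by move=> p; rewrite lee_fin mulr_ge0 // entry_weight_ge0.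
Qed.

Let resample_weight i : (\int[mu]_x (entry_weight i x)%:E =
  \int[mu]_x \int[Pk k]_z (entry_weight i (set_entry i k z x))%:E)%E.
Proof.
apply: (integral_resample model i k).
  by apply/measurable_EFinP; exact: measurable_entry_weight.
by move=> x; rewrite lee_fin entry_weight_ge0.
Qed.

Let resample_prod i : (\int[mu]_x (u (x.1 i k) * entry_weight i x)%:E =
  \int[mu]_x \int[Pk k]_z (u z * entry_weight i (set_entry i k z x))%:E)%E.
Proof.
rewrite (integral_resample model i k).
- by apply: eq_integral => x _; apply: eq_integral => z _; rewrite /= !eqxx.
- apply/measurable_EFinP; apply: measurable_funM; last exact: measurable_entry_weight.
  exact: (measurableT_comp mu_u (@measurable_entry R dW TW K i k)).
- by move=> x; rewrite lee_fin mulr_ge0 // entry_weight_ge0.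
Qed.

Let EFin_mean i (x : S) : (\int[Pk k]_z (entry_weight i (set_entry i k z x))%:E =
  (\int[Pk k]_z entry_weight i (set_entry i k z x))%:E)%E.
Proof. by rewrite /Rintegral fineK // integrable_fin_num. Qed.

Let EFin_prod i (x : S) : (\int[Pk k]_z (u z * entry_weight i (set_entry i k z x))%:E =
  (\int[Pk k]_z (u z * entry_weight i (set_entry i k z x)))%:E)%E.
Proof. by rewrite /Rintegral fineK // integrable_fin_num. Qed.

Let mean_weight_ge0 i (x : S) :
  (0 <= \int[Pk k]_z (entry_weight i (set_entry i k z x))%:E)%E.
Proof. by apply: integral_ge0 => z _; rewrite lee_fin entry_weight_ge0. Qed.

Let scaled_weight i : ((\int[Pk k]_z u z)%:E * \int[mu]_x (entry_weight i x)%:E =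
  \int[mu]_x ((\int[Pk k]_z u z)%:E *
    \int[Pk k]_z (entry_weight i (set_entry i k z x))%:E))%E.
Proof. by rewrite ge0_integralZl_EFin // resample_weight. Qed.

(** This is the decomposition at the constant 1, scaled by the mean of [u]. Its N = oo term equals
    that of [u], which leaves a comparison of two series entry by entry. *)
Let mC_split : {ae mu, forall x, (1 <= stopped_pulls (@policy) T k x)%E} ->
  ((\int[Pk k]_z u z)%:E * mu C =
  \sum_(i <oo) ((\int[Pk k]_z u z)%:E * \int[mu]_x (entry_weight i x)%:E) +
   (\int[Pk k]_z u z)%:E * mu (C `&` N @^-1` [set None]))%E.
Proof.
move=> N1; rewrite -integral_avg_or_mean1 // integral_avg_or_mean //.
rewrite cst1_int mul1e ge0_muleDr ?measure_ge0 //; last first.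
  apply: nneseries_ge0 => i _ _; apply: integral_ge0 => x _.
  by rewrite mul1r lee_fin entry_weight_ge0.
rewrite -nneseriesZl; last first.
  move=> i _; apply: integral_ge0 => x _.
  by rewrite mul1r lee_fin entry_weight_ge0.
congr (_ + _)%E; apply: eq_eseriesr => i _; congr (_ * _)%E.
by apply: eq_integral => x _; rewrite mul1r.
Qed.

(** Only the sign of products of increments is assumed, so the lemma covers both an increasing [u]
    with increasing weights and a decreasing [u] with decreasing weights. *)
Lemma mean_le_integral_avg_or_mean :
  {ae mu, forall x, (1 <= stopped_pulls (@policy) T k x)%E} ->
  (forall i (x : S) z z', 0 <= (u z - u z') *
    (entry_weight i (set_entry i k z x) - entry_weight i (set_entry i k z' x))) ->
  (((\int[Pk k]_z u z)%:E * mu C <= \int[mu]_(x in C) (avg_or_mean u x)%:E))%E.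
Proof.
move=> N1 co; rewrite mC_split // integral_avg_or_mean // leeD2r //.
apply: lee_nneseries => [i _ _|i _].
  by rewrite scaled_weight integral_ge0 // => x _; rewrite mule_ge0.
rewrite scaled_weight resample_prod; apply: ge0_le_integral => //.
- by move=> x _; rewrite mule_ge0.
- by apply: measurable_funeM.
- move=> x _; rewrite EFin_mean EFin_prod -EFinM lee_fin.
  exact: (chebyshev_integral u_int (weight_int i x) (prod_int i x) (co i x)).
Qed.

Lemma integral_avg_or_mean_le_mean :
  {ae mu, forall x, (1 <= stopped_pulls (@policy) T k x)%E} ->
  (forall i (x : S) z z', (u z - u z') *
    (entry_weight i (set_entry i k z x) - entry_weight i (set_entry i k z' x)) <= 0) ->
  ((\int[mu]_(x in C) (avg_or_mean u x)%:E <= (\int[Pk k]_z u z)%:E * mu C))%E.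
Proof.
move=> N1 co; rewrite mC_split // integral_avg_or_mean // leeD2r //.
have prod_ge0 i (x : S) :
    (0 <= \int[Pk k]_z (u z * entry_weight i (set_entry i k z x))%:E)%E.
  by apply: integral_ge0 => z _; rewrite lee_fin mulr_ge0 // entry_weight_ge0.
apply: lee_nneseries => [i _ _|i _].
  by rewrite resample_prod integral_ge0.
rewrite scaled_weight resample_prod; apply: ge0_le_integral => //.
- by apply: measurable_funeM.
- move=> x _; rewrite EFin_mean EFin_prod -EFinM lee_fin.
  exact: (chebyshev_integral_anti u_int (weight_int i x) (prod_int i x) (co i x)).
Qed.

End compare.
End core.

(** * Comparison for signed functions *)

Section signed.
Context {R : realType} {d : measure_display} {Omega : measurableType d}
  {P : probability Omega R} {dW : measure_display} {TW : measurableType dW}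
  {K : nat} (Pk : 'I_K -> probability R R)
  (X : nat -> 'I_K -> {RV P >-> R}) (W : nat -> {RV P >-> TW}).
Hypothesis model : tabular_model Pk X W.
Variable policy : forall t, hist R TW t -> 'I_K.
Arguments policy {t} _.
Hypothesis policy_meas : measurable_policy (@policy).
Let S := star R TW K.
Let mu : probability S R := star_law X W.
Variables (T : S -> option nat) (k : 'I_K) (C : set S).
Hypothesis T_stop : stopping_time (@policy) T.
Hypothesis mC : measurable C.
Hypothesis N_ge1 : {ae mu, forall x, (1 <= stopped_pulls (@policy) T k x)%E}.

Local Notation avg := (avg_or_mean Pk (@policy) T k).
Local Notation ew := (entry_weight (@policy) T k C).

Lemma avg_or_meanB (f g h : R -> R) x :
  (Pk k).-integrable setT (EFin \o g) -> (Pk k).-integrable setT (EFin \o h) ->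
  (forall z, f z = g z - h z) -> avg f x = avg g x - avg h x.
Proof.
move=> ig ih fE; rewrite /avg_or_mean; case: (total_pulls _ _ _ x) => [n|].
  rewrite /entry_avg -mulrBr -sumrB; congr (_ * _).
  by apply: eq_bigr => j _; rewrite fE.
rewrite -/(Rintegral _ _ _) -/(Rintegral _ _ g) -/(Rintegral _ _ h) -RintegralB //.
by apply: eq_Rintegral => z _.
Qed.

Lemma avg_or_mean_le (f g : R -> R) x :
  (Pk k).-integrable setT (EFin \o f) -> (Pk k).-integrable setT (EFin \o g) ->
  (forall z, f z <= g z) -> avg f x <= avg g x.
Proof.
move=> if_ ig fg; rewrite /avg_or_mean; case: (total_pulls _ _ _ x) => [n|].
  by rewrite ler_wpM2l // ler_sum.
by apply: le_Rintegral => // z _.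
Qed.

(** An increment of the positive part of f has the sign of that of f or is 0, and an increment of
    the negative part has the opposite sign or is 0. The two nonnegative comparisons thus apply in
    opposite directions, and they can be subtracted because [avg] of |f| has a finite integral.
    Integrability is part of the conclusion so that the case of -f can pull the sign out of the
    integral. *)
Lemma integral_avg_or_mean_le_mean_signed (f : R -> R) :
  (Pk k).-integrable setT (EFin \o f) ->
  (\int[mu]_(x in C) (avg (fun z => `|f z|%R) x)%:E < +oo)%E ->
  (forall i (x : S) z z', (f z - f z') *
    (ew i (set_entry i k z x) - ew i (set_entry i k z' x)) <= 0) ->
  [/\ mu.-integrable C (EFin \o avg f) &
    (\int[mu]_(x in C) (avg f x)%:E <= (\int[Pk k]_z f z)%:E * mu C)%E].
Proof.
move=> if_ fin anti.
have mf : measurable_fun setT f by apply/measurable_EFinP; exact: (measurable_int (Pk k)).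
pose fp z := Num.max (f z) 0; pose fm z := Num.max (- f z) 0.
have fE z : f z = fp z - fm z.
  rewrite /fp /fm; case: (leP (f z) 0) => h1; case: (leP (- f z) 0) => h2; lra.
have fp0 z : 0 <= fp z by rewrite le_max lexx orbT.
have fm0 z : 0 <= fm z by rewrite le_max lexx orbT.
have fpf z : fp z <= `|f z| by rewrite ge_max ler_norm normr_ge0.
have fmf z : fm z <= `|f z| by rewrite ge_max -normrN ler_norm normr_ge0.
have mfp : measurable_fun setT fp by exact: measurable_maxr.
have mfm : measurable_fun setT fm.
  by apply: measurable_maxr => //; exact: measurable_funN.
have iabs : (Pk k).-integrable setT (EFin \o (fun z => `|f z|)).
  exact: (integrable_abse if_).
have ifp : (Pk k).-integrable setT (EFin \o fp).
  apply: (le_integrable measurableT _ _ if_); first exact/measurable_EFinP.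
  by move=> z _; rewrite /= lee_fin ger0_norm.
have ifm : (Pk k).-integrable setT (EFin \o fm).
  apply: (le_integrable measurableT _ _ if_); first exact/measurable_EFinP.
  by move=> z _; rewrite /= lee_fin ger0_norm.
have mavg (g : R -> R) : measurable_fun setT g -> measurable_fun C (EFin \o avg g).
  move=> mg; apply/measurable_EFinP; apply: measurable_funTS.
  exact: measurable_avg_or_mean.
have iavg (g : R -> R) : measurable_fun setT g -> (Pk k).-integrable setT (EFin \o g) ->
    (forall z, 0 <= g z) -> (forall z, g z <= `|f z|) -> mu.-integrable C (EFin \o avg g).
  move=> mg ig g0 gf; apply/integrableP; split; first exact: mavg.
  apply: le_lt_trans fin; apply: ge0_le_integral => //.
  - by apply: measurableT_comp => //; exact: mavg.
  - by apply: mavg; exact: measurableT_comp.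
  - move=> x _; rewrite /= lee_fin ger0_norm ?avg_or_mean_ge0 //.
    exact: avg_or_mean_le.
have avgE x : avg f x = avg fp x - avg fm x by exact: avg_or_meanB.
have iavgp := iavg fp mfp ifp fp0 fpf.
have iavgm := iavg fm mfm ifm fm0 fmf.
have fpanti i (x : S) z z' : (fp z - fp z') *
    (ew i (set_entry i k z x) - ew i (set_entry i k z' x)) <= 0.
  have := anti i x z z'; rewrite /fp.
  case: (leP (f z) 0) => h1; case: (leP (f z') 0) => h2; nra.
have fmco i (x : S) z z' : 0 <= (fm z - fm z') *
    (ew i (set_entry i k z x) - ew i (set_entry i k z' x)).
  have := anti i x z z'; rewrite /fm.
  case: (leP (- f z) 0) => h1; case: (leP (- f z') 0) => h2; nra.
have Hp := integral_avg_or_mean_le_mean model policy_meas T_stop mC fp0 ifp N_ge1 fpanti.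
have Hm := mean_le_integral_avg_or_mean model policy_meas T_stop mC fm0 ifm N_ge1 fmco.
have avgEf : EFin \o avg f = (fun x => (avg fp x)%:E - (avg fm x)%:E)%E.
  by apply/funext => x /=; rewrite avgE EFinB.
rewrite avgEf; split; first exact: integrableB.
under eq_integral do rewrite avgE EFinB.
rewrite integralB //; apply: le_trans (leeB Hp Hm) _.
have fint : \int[Pk k]_z f z = \int[Pk k]_z fp z - \int[Pk k]_z fm z.
  by rewrite -RintegralB //; apply: eq_Rintegral => z _.
by rewrite fint -[mu C]fineK ?fin_num_measure // -!EFinM -EFinB lee_fin mulrBl.
Qed.

Lemma mean_le_integral_avg_or_mean_signed (f : R -> R) :
  (Pk k).-integrable setT (EFin \o f) ->
  (\int[mu]_(x in C) (avg (fun z => `|f z|%R) x)%:E < +oo)%E ->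
  (forall i (x : S) z z', 0 <= (f z - f z') *
    (ew i (set_entry i k z x) - ew i (set_entry i k z' x))) ->
  ((\int[Pk k]_z f z)%:E * mu C <= \int[mu]_(x in C) (avg f x)%:E)%E.
Proof.
move=> if_ fin co; pose g z := - f z.
have ig : (Pk k).-integrable setT (EFin \o g) by exact: (integrableN if_).
have i0 : (Pk k).-integrable setT (EFin \o cst 0) by exact: finite_measure_integrable_cst.
have avgE x : avg f x = - avg g x.
  rewrite (@avg_or_meanB f (cst 0) g) // => [|z]; last by rewrite sub0r opprK.
  rewrite -[RHS]sub0r; congr (_ - _).
  rewrite /avg_or_mean; case: (total_pulls _ _ _ x) => [n|].
    by rewrite /entry_avg big1 ?mulr0.
  by rewrite integral0.
have [] := @integral_avg_or_mean_le_mean_signed g ig.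
- rewrite (_ : (fun z => `|g z|) = (fun z => `|f z|)) //.
  by apply/funext => z; rewrite normrN.
- by move=> i x z z'; have := co i x z z'; rewrite /g; nra.
move=> iavg; rewrite [X in (_ <= X%:E * _)%E -> _](_ : _ = - \int[Pk k]_z f z).
  under [X in _ -> (_ <= X)%E]eq_integral do rewrite avgE EFinN.
  rewrite integralN; last exact: integrable_add_def.
  by rewrite EFinN mulNe leeNr.
rewrite -[RHS]mulN1r -RintegralZl //.
by apply: eq_Rintegral => z _; rewrite mulN1r.
Qed.

End signed.

(** * Back to the sample space *)

Lemma integral_star_law {R : realType} {d : measure_display}
    {Omega : measurableType d} {P : probability Omega R} {dW : measure_display}
    {TW : measurableType dW} {K : nat} (X : nat -> 'I_K -> {RV P >-> R})
    (W : nat -> {RV P >-> TW}) (C : set (star R TW K)) (f : star R TW K -> \bar R) :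
  measurable C -> measurable_fun setT f ->
  (\int[P]_(w in realized_star X W @^-1` C) f (realized_star X W w) =
   \int[star_law X W]_(x in C) f x)%E.
Proof.
move=> mC mf; rewrite integralE [RHS]integralE.
have pf g : measurable_fun setT g -> (forall x, (0 <= g x)%E) ->
  (\int[star_law X W]_(x in C) g x =
   \int[P]_(w in realized_star X W @^-1` C) g (realized_star X W w))%E.
  move=> mg g0; apply: ge0_integral_pushforward => //.
  exact: measurable_funTS.
rewrite !pf //; [|exact: measurable_funeneg|exact: measurable_funepos].
by congr (_ - _)%E; apply: eq_integral => w _; rewrite ?funeposE ?funenegE.
Qed.

(** A null set of [Omega] need not be the preimage of a set of data values; measurability of [B]
    lets its own complement serve as the null set. *)
Lemma ae_star_law {R : realType} {d : measure_display}
    {Omega : measurableType d} {P : probability Omega R} {dW : measure_display}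
    {TW : measurableType dW} {K : nat} (X : nat -> 'I_K -> {RV P >-> R})
    (W : nat -> {RV P >-> TW}) (B : set (star R TW K)) :
  measurable B -> {ae P, forall w, B (realized_star X W w)} ->
  {ae star_law X W, forall x, B x}.
Proof.
move=> mB [N [mN N0 BN]]; exists (~` B); split => //; first exact: measurableC.
apply/eqP; rewrite -measure_le0 -N0.
apply: (le_measure P) => //; rewrite inE //.
apply: (measurable_funPTI (realized_star X W)).
exact: measurableC.
Qed.

Lemma stopped_emp_cdfE {R : realType} {dW : measure_display}
    {TW : measurableType dW} {K : nat} (policy : forall t, hist R TW t -> 'I_K)
    T k y (x : data_star K R TW) :
  stopped_emp_cdf policy T k y x =
  stopped_emp_mean policy T k (fun z => (z <= y)%R%:R) x.
Proof. by congr (lim (_ @ \oo)); apply/funext => t; rewrite emp_cdfE. Qed.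

Theorem theorem2 (R : realType)
    (d : measure_display) (Omega : measurableType d) (P : probability Omega R)
    (dW : measure_display) (TW : measurableType dW)
    (K : nat) (Pk : 'I_K -> probability R R)
    (mean_fin : forall a, (Pk a).-integrable setT (fun z : R => z%:E))
    (X : nat -> 'I_K -> {RV P >-> R}) (W : nat -> {RV P >-> TW})
    (model : tabular_model Pk X W)
    (policy : forall t, hist R TW t -> 'I_K) (policy_meas : measurable_policy policy)
    (T : data_star K R TW -> option nat) (T_stop : stopping_time policy T)
    (k : 'I_K)
    (N_ge1 : {ae P, forall w, (1 <= stopped_pulls policy T k (realized_data X W w))%E})
    (C : set (data_star K R TW)) (C_FT : stopped_sigma_algebra policy T C)
    (C_pos : (0 < P (realized_data X W @^-1` C))%E) :
  let E_given_C (Z : data_star K R TW -> R) : \bar R :=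
    cond_expectation P (realized_data X W @^-1` C)
      (fun w => Z (realized_data X W w)) in
  ((forall i, decreasing_in_entry i k (weight policy T C k)) ->
     (0 <= ereal_inf (range (fun y : R =>
        E_given_C (stopped_emp_cdf policy T k y) - Pk k `]-oo, y]%classic)))%E /\
     (forall f : R -> R, {homo f : z1 z2 / z1 <= z2} ->
        (E_given_C (stopped_emp_mean policy T k (fun z => `|f z|%R)) < +oo)%E ->
        (\int[Pk k]_z `|f z|%R%:E < +oo)%E ->
        (E_given_C (stopped_emp_mean policy T k f) <= \int[Pk k]_z (f z)%:E)%E))
  /\
  ((forall i, increasing_in_entry i k (weight policy T C k)) ->
     (ereal_sup (range (fun y : R =>
        E_given_C (stopped_emp_cdf policy T k y) - Pk k `]-oo, y]%classic)) <= 0)%E /\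
     (forall f : R -> R, {homo f : z1 z2 / z1 <= z2} ->
        (E_given_C (stopped_emp_mean policy T k (fun z => `|f z|%R)) < +oo)%E ->
        (\int[Pk k]_z `|f z|%R%:E < +oo)%E ->
        (\int[Pk k]_z (f z)%:E <= E_given_C (stopped_emp_mean policy T k f))%E)).
Proof.
pose mu := star_law X W.
have mC : @measurable _ (star R TW K) C by rewrite star_measurableE; exact: C_FT.1.
have muC0 : (0 < mu C)%E by exact: C_pos.
have muC : mu C = (fine (mu C))%:E by rewrite fineK // fin_num_measure.
have c0 : 0 < fine (mu C) by rewrite -lte_fin -muC.
have N1 : {ae mu, forall x, (1 <= stopped_pulls policy T k x)%E}.
  apply: (@ae_star_law _ _ _ _ _ _ _ X W
    [set x | (1 <= stopped_pulls policy T k x)%E]) => //.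
  rewrite (_ : [set _ | _] = ~` (total_pulls policy T k @^-1` [set Some 0%N])).
    by apply: measurableC; exact: measurable_total_pulls.
  apply/seteqP; split => x /=; rewrite stopped_pullsE.
    case: (total_pulls _ _ _ x) => [n|] //; rewrite lee_fin ler1n => n0 [n0'].
    by move: n0; rewrite n0'.
  by case: (total_pulls _ _ _ x) => [[|n]|] // _; rewrite ?leey // lee_fin ler1n.
move=> E_given_C.
(* Conditional expectations are carried to the law of the data, where the strong law replaces the
   stopped mean by [avg_or_mean] off a null set. *)
have EE (u : R -> R) : (Pk k).-integrable setT (EFin \o u) ->
    E_given_C (stopped_emp_mean policy T k u) =
    ((\int[mu]_(x in C) (avg_or_mean Pk policy T k u x)%:E) *
      (fine (mu C))^-1%:E)%E.
  have <- : ((mu C)^-1 = ((fine (mu C))^-1)%:E)%E.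
    by rewrite {1}muC inver gt_eqF.
  move=> iu; have mu_ : measurable_fun setT u.
    by apply/measurable_EFinP; exact: (measurable_int (Pk k)).
  have msemp := measurable_stopped_emp_mean policy_meas T_stop k mu_.
  rewrite /E_given_C /cond_expectation; congr (_ / _)%E.
  transitivity (\int[mu]_(x in C) (stopped_emp_mean policy T k u x)%:E)%E.
    apply: (@integral_star_law _ _ _ _ _ _ _ X W C
      (fun x => (stopped_emp_mean policy T k u x)%:E)) => //.
    exact/measurable_EFinP.
  apply: ae_eq_integral => //.
  - by apply: measurable_funTS; exact/measurable_EFinP.
  - apply: measurable_funTS; apply/measurable_EFinP.
    exact: measurable_avg_or_mean.
  - have := eq_stopped_emp_mean model policy T iu.
    by apply: (@filterS _ (almost_everywhere mu)) => x /= e _; rewrite e.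
have indE y : (fun z : R => (z <= y)%R%:R) = \1_(`]-oo, y]%classic) :> (R -> R).
  apply/funext => z; rewrite indicE; congr (nat_of_bool _)%:R.
  by apply/idP/idP; rewrite inE /= in_itv.
have mind y : measurable_fun setT (fun z : R => (z <= y)%R%:R : R).
  by rewrite indE; exact: measurable_indic.
have ind_int y : (Pk k).-integrable setT (EFin \o (fun z : R => (z <= y)%R%:R)).
  apply: (@le_integrable _ _ _ _ _ _ _ (EFin \o cst 1)) => //.
  - exact/measurable_EFinP.
  - by move=> z _; rewrite /= lee_fin normr1; case: (z <= y); rewrite ?normr1 ?normr0.
  - exact: finite_measure_integrable_cst.
(* Measurability of f comes from its monotonicity. *)
have f_int (f : R -> R) : {homo f : z1 z2 / z1 <= z2} ->
    (\int[Pk k]_z `|f z|%R%:E < +oo)%E -> (Pk k).-integrable setT (EFin \o f).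
  move=> fh fin; apply/integrableP; split => //.
  by apply/measurable_EFinP; apply: nondecreasing_measurable => // z1 z2 _ _; exact: fh.
have f_fin (f : R -> R) : (Pk k).-integrable setT (EFin \o f) ->
    (E_given_C (stopped_emp_mean policy T k (fun z => `|f z|%R)) < +oo)%E ->
    (\int[mu]_(x in C) (avg_or_mean Pk policy T k (fun z => `|f z|%R) x)%:E < +oo)%E.
  move=> if_; rewrite EE; last exact: (integrable_abse if_).
  (* Scaling by the inverse of the positive finite mass of C would keep an infinite integral
     infinite. *)
  rewrite !ltey; apply: contra => /eqP ->.
  by rewrite gt0_mulye // lte_fin invr_gt0.
have f_mean (f : R -> R) : (Pk k).-integrable setT (EFin \o f) ->
    (\int[Pk k]_z (f z)%:E = (\int[Pk k]_z f z)%:E)%E.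
  by move=> if_; rewrite /Rintegral fineK // integrable_fin_num.
have ind_mean y : ((\int[Pk k]_z (z <= y)%R%:R)%:E = Pk k `]-oo, y]%classic)%E.
  rewrite -f_mean //.
  transitivity (\int[Pk k]_z (\1_(`]-oo, y]%classic) z)%:E)%E; first by rewrite -indE.
  by rewrite integral_indic // setIT.
have co f : (forall i, increasing_in_entry i k (weight policy T C k)) ->
    {homo f : z1 z2 / z1 <= z2} -> forall i x z z', 0 <= (f z - f z') *
    (entry_weight policy T k C i (set_entry i k z x) -
     entry_weight policy T k C i (set_entry i k z' x)).
  move=> mono fh i x z z'; have [zz'|/ltW zz'] := leP z z'.
    by apply: mulr_le0; rewrite subr_le0 ?fh ?entry_weight_increasing.
  by apply: mulr_ge0; rewrite subr_ge0 ?fh ?entry_weight_increasing.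
have anti f : (forall i, decreasing_in_entry i k (weight policy T C k)) ->
    {homo f : z1 z2 / z1 <= z2} -> forall i x z z', (f z - f z') *
    (entry_weight policy T k C i (set_entry i k z x) -
     entry_weight policy T k C i (set_entry i k z' x)) <= 0.
  move=> mono fh i x z z'; have [zz'|/ltW zz'] := leP z z'.
    by apply: mulr_le0_ge0; rewrite ?subr_le0 ?subr_ge0 ?fh ?entry_weight_decreasing.
  by apply: mulr_ge0_le0; rewrite ?subr_le0 ?subr_ge0 ?fh ?entry_weight_decreasing.
(* The indicator behind the CDF is decreasing, so [co] and [anti] are applied to its negative and
   the sign is flipped afterwards. Being nonnegative, the indicator itself needs no splitting. *)
have indN y : {homo (fun z : R => - (z <= y)%R%:R : R) : z1 z2 / z1 <= z2}.
  move=> z1 z2 z12; rewrite lerN2; have [z2y|//] := leP z2 y.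
  by rewrite (le_trans z12 z2y).
have indEE y : E_given_C (stopped_emp_cdf policy T k y) =
    E_given_C (stopped_emp_mean policy T k (fun z => (z <= y)%R%:R)).
  by rewrite /E_given_C /cond_expectation; under eq_integral do rewrite stopped_emp_cdfE.
split=> mono; split.
- apply: le_ereal_inf_tmp => _ [y _ <-]; rewrite sube_ge0 ?fin_num_measure //.
  rewrite indEE EE // lee_pdivlMr // -muC -ind_mean.
  apply: (mean_le_integral_avg_or_mean model policy_meas T_stop mC) => //.
  by move=> i x z z'; have := anti _ mono (indN y) i x z z'; lra.
- move=> f fh ffin /f_int-/(_ fh) if_.
  have [_ H] := integral_avg_or_mean_le_mean_signed model policy_meas T_stop mC N1
    if_ (f_fin f if_ ffin) (anti f mono fh).
  by rewrite EE // f_mean // lee_pdivrMr // -muC.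
- apply: ge_ereal_sup => _ [y _ <-]; rewrite sube_le0.
  rewrite indEE EE // lee_pdivrMr // -muC -ind_mean.
  apply: (integral_avg_or_mean_le_mean model policy_meas T_stop mC) => //.
  by move=> i x z z'; have := co _ mono (indN y) i x z z'; lra.
- move=> f fh ffin /f_int-/(_ fh) if_.
  rewrite EE // f_mean // lee_pdivlMr // -muC.
  apply: (mean_le_integral_avg_or_mean_signed model policy_meas T_stop mC N1) => //.
    exact: f_fin.
  exact: co.
Qed.
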